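(* Let $c\ge 2$ be an integer and suppose that every agent $i\in N$ has a $\{1,c\}$-SUB valuation $v_i$. For all sufficiently large positive $M$, the Bivalued Yankee Swap algorithm, run with the gain function $$\phi(X,i,d)=\begin{cases}\dfrac{v_i(X_i)+d}{v_i(X_i)} & \text{if } v_i(X_i)>0,\\[2mm] M d & \text{if } v_i(X_i)=0,\end{cases}$$ computes a max Nash welfare allocation, i.e. an allocation $X$ that maximizes the number $|P_X|$ of agents with positive utility (where $P_X=\{i\in N: v_i(X_i)>0\}$) and, subject to that, maximizes $\prod_{i\in P_X}v_i(X_i)$.
   Context: **Setting.** $N=\{1,\dots,n\}$ is a set of agents and $G$ a finite set of $m$ goods. Write $S+g=S\cup\{g\}$, $S-g=S\setminus\{g\}$, $N+0=N\cup\{0\}$. For $v:2^G\to\mathbb{R}_{\ge0}$ let $\Delta_v(S,g)=v(S+g)-v(S)$. $v$ is $\{1,c\}$-SUB if $v(\emptyset)=0$; $\Delta_v(S,g)\in\{1,c\}$ for all $S\subseteq G$, $g\in G\setminus S$; and $\Delta_v(S,g)\ge\Delta_v(T,g)$ for all $S\subseteq T\subseteq G$, $g\in G\setminus T$. An allocation $X=(X_0,X_1,\dots,X_n)$ is a partition of $G$ into $n+1$ (possibly empty) bundles; $X_i$ goes to agent $i\in N$ and $X_0$ is unallocated. **Clean allocations and exchange graph.** The dummy agent $0$ has valuation $v_0(S)=c|S|$. For $i\in N+0$ let $\beta_i(S)=\max\{|T|:T\subseteq S,\ v_i(T)=c|T|\}$. An allocation $X$ is clean if $\beta_i(X_i)=|X_i|$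 for all $i\in N+0$. For a clean allocation $X$, the exchange graph $\mathcal G(X)$ is the directed graph on $G$ with an edge $g\to g'$ if $g\in X_j$ and $\beta_j(X_j-g+g')=\beta_j(X_j)$ for some $j\in N+0$. $F_i(X)=\{g\in G:\beta_i(X_i+g)-\beta_i(X_i)=1\}$. For a clean allocation $X^c$ and a tuple $X^1=(X^1_1,\dots,X^1_n)$ of disjoint subsets of $X^c_0$, $X^c\cup X^1$ denotes the allocation giving $X^c_i\cup X^1_i$ to each $i\in N$ and leaving the rest unallocated. **Bivalued Yankee Swap with gain function $\phi$.** Initialize $X^c=(G,\emptyset,\dots,\emptyset)$, $X^1=(\emptyset,\dots,\emptyset)$, $U=N$. While $\sum_{h\in N}|X^1_h|<|X^c_0|$, perform one iteration: let $\mathrm{Gain}_c=\max_{k\in U}\phi(X^c\cup X^1,k,c)$ ($-\infty$ if $U=\emptyset$) and $\mathrm{Gain}_1=\max_{k\in N\setminus U}\phi(X^c\cup X^1,k,1)$ ($-\infty$ if $N\setminus U=\emptyset$). - If $\mathrm{Gain}_c\ge\mathrm{Gain}_1$: choose the smallest-index $i\in U$ attaining $\mathrm{Gain}_c$. If there is a path in $\mathcal G(X^c)$ from $F_i(X^c)$ to $X^c_0$, take a shortest such path $(g'_1,\dots,g'_t)$ and update $X^c$ by moving $g'_{s+1}$ to the bundle that contained $g'_s$ for $1\le s<t$, and moving $g'_1$ to $X^c_i$ (so $g'_t$ leaves $X^c_0$); if $g'_t\in X^1_j$ for some $j\in N$, replace $X^1_j$ by $X^1_j-g'_t+g$ for an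 arbitrary $g\in X^c_0\setminus\bigcup_{h\in N}X^1_h$. If no such path exists, remove $i$ from $U$. - If $\mathrm{Gain}_c<\mathrm{Gain}_1$: choose the smallest-index $i\in N\setminus U$ attaining $\mathrm{Gain}_1$ and add to $X^1_i$ an arbitrary $g\in X^c_0\setminus\bigcup_{h\in N}X^1_h$. When the loop ends, output $X^c\cup X^1$. *)

(* Defs.v *)
From mathcomp Require Import all_boot all_order all_algebra.
From mathcomp Require Import reals constructive_ereal.
Set Implicit Arguments.
Unset Strict Implicit.
Unset Printing Implicit Defensive.
Import Order.TTheory GRing.Theory Num.Theory.
Local Open Scope ring_scope.

Definition marginal (R : realType) (G : finType) (v : {set G} -> R)
    (S : {set G}) (g : G) : R :=
  v (g |: S) - v S.

Definition one_c_SUB (R : realType) (G : finType) (c : R)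
    (v : {set G} -> R) : Prop :=
  [/\ v set0 = 0,
      forall (S : {set G}) (g : G), g \notin S ->
        marginal v S g = 1 \/ marginal v S g = c
    & forall (S T : {set G}) (g : G), S \subset T -> g \notin T ->
        marginal v T g <= marginal v S g].

(* The agents are 'I_n, and N + 0 is option 'I_n, with None for the dummy
   agent 0.  A partition of G into n + 1 possibly empty bundles is given by
   the function sending each good to the index of the bundle containing it. *)
Definition allocation (n : nat) (G : finType) := {ffun G -> option 'I_n}.

Definition bundle (n : nat) (G : finType) (X : allocation n G)
    (j : option 'I_n) : {set G} :=
  [set g | X g == j].

Section Exchange.

Context (R : realType) (n : nat) (G : finType).
Context (c : R) (v : 'I_n -> {set G} -> R).

Definition dummy_val (S : {set G}) : R := c * #|S|%:R.

Definition val0 (j : option 'I_n) : {set G} -> R :=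
  if j is Some i then v i else dummy_val.

Definition beta (j : option 'I_n) (S : {set G}) : nat :=
  \max_(T : {set G} | (T \subset S) && (val0 j T == c * #|T|%:R)) #|T|.

Definition exchange_edge (X : allocation n G) : rel G := fun g g' =>
  [exists j : option 'I_n, (g \in bundle X j) &&
    (beta j (g' |: (bundle X j :\ g)) == beta j (bundle X j))].

(* The difference of the beta's is written additively: subtraction on nat
   is truncated. *)
Definition F_set (X : allocation n G) (i : 'I_n) : {set G} :=
  [set g | beta (Some i) (g |: bundle X (Some i))
           == (beta (Some i) (bundle X (Some i)) + 1)%N].

Definition transfer_path (X : allocation n G) (i : 'I_n) (p : seq G) : bool :=
  if p is g :: q then
    [&& g \in F_set X i, path (exchange_edge X) g q
      & last g q \in bundle X None]
  else false.

Definition shortest_transfer_path (X : allocation n G) (i : 'I_n)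
    (p : seq G) : Prop :=
  transfer_path X i p /\
  forall p' : seq G, transfer_path X i p' -> (size p <= size p')%N.

End Exchange.

(* Along p = [:: g_1; ...; g_t], g_1 goes to agent i and g_(s+1) goes to the
   former owner of g_s: the list of new owners is the list of old owners
   shifted by one. *)
Definition transfer (n : nat) (G : finType) (X : allocation n G) (i : 'I_n)
    (p : seq G) : allocation n G :=
  [ffun g => if g \in p then nth None (Some i :: map X p) (index g p)
             else X g].

(* In st_one, encoding (X^1_1, ..., X^1_n), the index None collects the goods
   that lie in no X^1_i. *)
Record state (n : nat) (G : finType) := State {
  st_c : allocation n G;
  st_one : allocation n G;
  st_U : {set 'I_n}
}.

(* Intended for X1 whose sets X1_i are all included in the bundle 0 of Xc. *)
Definition alloc_union (n : nat) (G : finType) (Xc X1 : allocation n G) :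
    allocation n G :=
  [ffun g => if Xc g is Some i then Some i else X1 g].

Section YankeeSwap.

Context (R : realType) (n : nat) (G : finType).
Context (c : R) (v : 'I_n -> {set G} -> R).
Context (phi : allocation n G -> 'I_n -> R -> R).

Definition init_state : state n G :=
  State [ffun=> None] [ffun=> None] [set: 'I_n].

Definition output (s : state n G) : allocation n G :=
  alloc_union (st_c s) (st_one s).

Definition running (s : state n G) : bool :=
  (\sum_(h < n) #|bundle (st_one s) (Some h)| < #|bundle (st_c s) None|)%N.

Definition free_goods (s : state n G) : {set G} :=
  bundle (st_c s) None :\: \bigcup_(h < n) bundle (st_one s) (Some h).

Definition Gain_c (s : state n G) : \bar R :=
  \big[maxe/-oo%E]_(k in st_U s) (phi (output s) k c)%:E.

Definition Gain_1 (s : state n G) : \bar R :=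
  \big[maxe/-oo%E]_(k in ~: st_U s) (phi (output s) k 1)%:E.

Definition picked_c (s : state n G) (i : 'I_n) : Prop :=
  [/\ i \in st_U s, (phi (output s) i c)%:E = Gain_c s
    & forall k : 'I_n, k \in st_U s ->
        (phi (output s) k c)%:E = Gain_c s -> (i <= k)%N].

Definition picked_1 (s : state n G) (i : 'I_n) : Prop :=
  [/\ i \in ~: st_U s, (phi (output s) i 1)%:E = Gain_1 s
    & forall k : 'I_n, k \in ~: st_U s ->
        (phi (output s) k 1)%:E = Gain_1 s -> (i <= k)%N].

(* One iteration of the loop body.  The paths are written g :: q, so that
   their last vertex is last g q. *)
Inductive step (s : state n G) : state n G -> Prop :=
| StepTransfer (i : 'I_n) (g : G) (q : seq G) :
    (Gain_1 s <= Gain_c s)%E -> picked_c s i ->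
    shortest_transfer_path c v (st_c s) i (g :: q) ->
    st_one s (last g q) = None ->
    step s (State (transfer (st_c s) i (g :: q)) (st_one s) (st_U s))
| StepTransferReplace (i : 'I_n) (g : G) (q : seq G) (j : 'I_n) (h : G) :
    (Gain_1 s <= Gain_c s)%E -> picked_c s i ->
    shortest_transfer_path c v (st_c s) i (g :: q) ->
    st_one s (last g q) = Some j ->
    h \in free_goods s ->
    step s (State (transfer (st_c s) i (g :: q))
                  [ffun x => if x == last g q then None
                             else if x == h then Some j else st_one s x]
                  (st_U s))
| StepRemove (i : 'I_n) :
    (Gain_1 s <= Gain_c s)%E -> picked_c s i ->
    (forall p : seq G, ~~ transfer_path c v (st_c s) i p) ->
    step s (State (st_c s) (st_one s) (st_U s :\ i))
| StepOne (i : 'I_n) (h : G) :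
    (Gain_c s < Gain_1 s)%E -> picked_1 s i ->
    h \in free_goods s ->
    step s (State (st_c s)
                  [ffun x => if x == h then Some i else st_one s x]
                  (st_U s)).

(* Total correctness from s: whatever the arbitrary choices (shortest paths
   and free goods), the loop never gets stuck, it terminates (the predicate is
   inductive), and the output satisfies Q. *)
Inductive all_runs (Q : allocation n G -> Prop) (s : state n G) : Prop :=
| RunsHalt : ~~ running s -> Q (output s) -> all_runs Q s
| RunsStep : running s -> (exists s' : state n G, step s s') ->
    (forall s' : state n G, step s s' -> all_runs Q s') -> all_runs Q s.

Definition yankee_swap_computes (Q : allocation n G -> Prop) : Prop :=
  all_runs Q init_state.

End YankeeSwap.

Definition nash_gain (R : realType) (n : nat) (G : finType)
    (v : 'I_n -> {set G} -> R) (M : R)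
    (X : allocation n G) (i : 'I_n) (d : R) : R :=
  let u := v i (bundle X (Some i)) in
  if 0 < u then (u + d) / u else M * d.

Definition positive_agents (R : realType) (n : nat) (G : finType)
    (v : 'I_n -> {set G} -> R) (X : allocation n G) : {set 'I_n} :=
  [set i | 0 < v i (bundle X (Some i))].

Definition nash_product (R : realType) (n : nat) (G : finType)
    (v : 'I_n -> {set G} -> R) (X : allocation n G) : R :=
  \prod_(i in positive_agents v X) v i (bundle X (Some i)).

Definition max_nash_welfare (R : realType) (n : nat) (G : finType)
    (v : 'I_n -> {set G} -> R) (X : allocation n G) : Prop :=
  (forall Y : allocation n G,
     (#|positive_agents v Y| <= #|positive_agents v X|)%N) /\
  (forall Y : allocation n G,
     #|positive_agents v Y| = #|positive_agents v X| ->
     nash_product v Y <= nash_product v X).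

(* Main.v *)
Require Import Defs.
From mathcomp Require Import all_boot all_order all_algebra.
From mathcomp Require Import reals.
From mathcomp Require Import constructive_ereal zify lra.
Import Order.TTheory GRing.Theory Num.Theory.
Local Open Scope ring_scope.
Set Implicit Arguments.
Unset Strict Implicit.
Unset Printing Implicit Defensive.

(* Each beta_i is a matroid rank function and v_i(S) = |S| + (c - 1) beta_i(S).
   Hence the utilities of an allocation are c a_i + b_i, where a is the vector
   of bundle sizes of a clean allocation and b counts the goods of value 1.
   We maximize the product of the weights of c a_i + b_i over all
   such pairs (a, b) using at most |G| goods, where the weight of u > 0 is u and
   that of 0 is 1/M; for large M, maximizing this product is maximizing Nash
   welfare.  The gain of a step is a ratio of weights, and the gain of a c-step
   of an agent with vector entry a_i is at least the gain of a 1-step of an agent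
   of utility u exactly when a_i <= u, so the choices do not depend on M.

   Throughout the run some optimal pair dominates the current pair (a, b)
   componentwise: when a step leaves the dominated region, the optimal pair is
   repaired by a one-sided exchange in the polymatroid of clean vectors, without
   loss of weight.  When all goods are used up, the two pairs coincide. *)

(** * Matroid rank functions: spans, bases and exchange *)

Section MatroidRank.

Local Open Scope nat_scope.

Variable G : finType.
Implicit Types (A B D S T : {set G}) (g x y z : G).

Lemma setU1_ind (P : {set G} -> Prop) :
  P set0 -> (forall g S, g \notin S -> P S -> P (g |: S)) -> forall S, P S.
Proof.
move=> P0 PS S; have [n] := ubnP #|S|; elim: n S => // n IH S.
have [->//|[g gS]] := set_0Vmem S; rewrite (cardsD1 g) gS add1n ltnS => Sn.
by rewrite -(setD1K gS); apply: PS; [rewrite setD11 | apply: IH].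
Qed.

Lemma setD1_notin x A : x \notin A -> A :\ x = A.
Proof. by move=> xA; apply/setDidPl; rewrite disjoint_sym disjoints1. Qed.

(** The element [g] may already belong to the sets, which avoids membership side conditions.
    Submodularity takes the form of diminishing marginals, written additively because subtraction on
    nat truncates. *)
Definition matroid_rank (r : {set G} -> nat) : Prop :=
  [/\ r set0 = 0, forall S g, r S <= r (g |: S) <= (r S).+1
    & forall S T g, S \subset T -> r (g |: T) + r S <= r (g |: S) + r T].

Definition indep (r : {set G} -> nat) S := r S == #|S|.

Variable r : {set G} -> nat.
Hypothesis rP : matroid_rank r.

Lemma rank0 : r set0 = 0. Proof. by case: rP. Qed.

Lemma rank_setU A B D : A \subset B -> r (D :|: B) + r A <= r (D :|: A) + r B.
Proof.
move=> AB; elim/setU1_ind: D => [|g D _ IH]; first by rewrite !set0U addnC.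
case: rP => _ _ /(_ (D :|: A) (D :|: B) g (setUS _ AB)).
by rewrite -!setUA; lia.
Qed.

Lemma rank_mono A B : A \subset B -> r A <= r B.
Proof.
move=> AB; rewrite -(setUidPr AB); elim/setU1_ind: B {AB} => [|g B _ IH].
  by rewrite setU0.
by apply: leq_trans IH _; rewrite setUCA; case: rP => _ /(_ (A :|: B) g) /andP[].
Qed.

Lemma rank_setU_le A B : r (A :|: B) <= r A + r B.
Proof. by have := rank_setU A (sub0set B); rewrite setU0 rank0 addn0. Qed.

Lemma rank_card A : r A <= #|A|.
Proof.
elim/setU1_ind: A => [|g A gA IH]; first by rewrite rank0.
by rewrite cardsU1 gA; case: rP => _ /(_ A g) /andP[_ h] _; lia.
Qed.

Lemma rank_setIU A B : r (A :|: B) + r (A :&: B) <= r A + r B.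
Proof.
have := rank_setU A (subsetIr A B); rewrite (setUidPl (subsetIl A B)); lia.
Qed.

Lemma indepS A B : A \subset B -> indep r B -> indep r A.
Proof.
move=> AB /eqP iB; rewrite /indep eqn_leq rank_card /=.
have := rank_setU_le A (B :\: A); rewrite setDE setUIr setUCr setIT.
rewrite (setUidPr AB) iB -setDE.
have := rank_card (B :\: A); rewrite cardsD (setIidPr AB).
have := subset_leq_card AB; lia.
Qed.

(** The equation [r (z |: A) = r A] encodes that [z] lies in the span of [A]; spans grow with the
    set by diminishing marginals. *)
Lemma rank_span A B z : A \subset B -> r (z |: A) = r A -> r (z |: B) = r B.
Proof.
move=> AB zA; case: rP => _ /(_ B z) /andP[h _] /(_ A B z AB); lia.
Qed.

Lemma rank_span_set A D :
  (forall z, z \in D -> r (z |: A) = r A) -> r (D :|: A) = r A.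
Proof.
elim/setU1_ind: D => [|g D _ IH] DA; first by rewrite set0U.
rewrite -setUA (@rank_span A) ?subsetUr ?DA ?setU11 //.
by apply: IH => z zD; apply: DA; rewrite setU1r.
Qed.

(** The basis is built greedily: an element that raises the rank of [S] also raises that of the
    smaller [T], by diminishing marginals. *)
Lemma basis_ex S : exists2 T : {set G}, T \subset S & indep r T /\ #|T| = r S.
Proof.
elim/setU1_ind: S => [|g S gS [T TS [/eqP iT cT]]].
  by exists set0; rewrite // /indep rank0 cards0.
have TgS := subset_trans TS (subsetU1 g S).
have [e|ne] := eqVneq (r (g |: S)) (r S); first by exists T; rewrite // /indep iT e.
exists (g |: T); first by rewrite setUS.
have gT : g \notin T by apply: contra gS => /(subsetP TS).
rewrite /indep cardsU1 gT.
case: rP => _ mono /(_ T S g TS) h.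
have /andP[h1 h2] := mono T g; have /andP[h3 h4] := mono S g.
by split; [apply/eqP|]; lia.
Qed.

Lemma rank_setU1_indep A z : indep r A -> z \notin A ->
  indep r (z |: A) = (r (z |: A) != r A).
Proof.
move=> /eqP iA zA; rewrite /indep cardsU1 zA iA.
by case: rP => _ /(_ A z) /andP[h1 h2] _; rewrite iA in h1 h2; apply/idP/idP; lia.
Qed.

(** Both [B] and [z |: (B :\ y)] span [z |: B], so they are interchangeable under any union. *)
Lemma rank_exchange B W y z : y \in B -> r (z |: B) = r B ->
  r (z |: (B :\ y)) = r B -> r (W :|: (z |: (B :\ y))) = r (W :|: B).
Proof.
move=> yB zB zBy.
have e1 : r (W :|: (z |: B)) = r (W :|: B).
  by rewrite setUCA (@rank_span B) ?subsetUr.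
rewrite -e1 -{2}(setD1K yB) (setUCA [set z]) (setUCA W [set y]).
by rewrite (@rank_span (z |: B :\ y)) ?subsetUr // setUCA setD1K // zB zBy.
Qed.

(* Inside an independent set, the span of an intersection is the intersection
   of the spans; A :\: D is the intersection of the sets A :\ g, g in D. *)
Lemma rank_span_setD A D z : indep r A -> r (z |: A) = r A ->
  (forall g, g \in A :&: D -> r (z |: (A :\ g)) = r (A :\ g)) ->
  r (z |: (A :\: D)) = r (A :\: D).
Proof.
move=> iA zA; elim/setU1_ind: D => [|g D gD IH] zD; first by rewrite setD0.
have {IH}IH : r (z |: (A :\: D)) = r (A :\: D).
  by apply: IH => x; rewrite inE => /andP[xA xD]; apply: zD; rewrite !inE xA xD orbT.
have [gA|gA] := boolP (g \in A); last first.
  rewrite (_ : A :\: (g |: D) = A :\: D) //; apply/setP => x; rewrite !inE.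
  by have [->|] := eqVneq x g; rewrite ?(negPf gA) ?andbF.
have {}zg : r (z |: (A :\ g)) = r (A :\ g) by apply: zD; rewrite !inE gA eqxx.
have -> : A :\: (g |: D) = (A :\ g) :&: (A :\: D).
  by apply/setP => x; rewrite !inE; case: (x \in D); case: (x \in A); case: (x == g).
have eU : (A :\ g) :|: (A :\: D) = A.
  apply/setP => x; rewrite !inE; have [->|_] := eqVneq x g; first by rewrite gD gA.
  by case: (x \in A); rewrite ?andbF.
(* On subsets of the independent set [A] the rank is the cardinality, hence modular; submodularity
   then leaves no room for [z] to raise the rank of the intersection. *)
have := rank_setIU (z |: (A :\ g)) (z |: (A :\: D)).
rewrite -setUUr -setUIr eU zA zg IH.
have ind B : B \subset A -> r B = #|B| by move=> BA; apply/eqP/(indepS BA).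
rewrite (ind _ (subxx A)) (ind _ (subsetDl A [set g])) (ind _ (subsetDl A D)).
have IA : (A :\ g) :&: (A :\: D) \subset A.
  by apply: subset_trans (subsetIl _ _) (subsetDl _ _).
rewrite (ind _ IA); have := cardsUI (A :\ g) (A :\: D); rewrite eU => e h.
have := rank_mono (subsetU1 z ((A :\ g) :&: (A :\: D))).
rewrite (ind _ IA); lia.
Qed.

End MatroidRank.

(** * Allocations and the size vectors of clean allocations *)

Section Allocations.

Local Open Scope nat_scope.

Variables (n : nat) (G : finType).
Implicit Types (X Z : allocation n G) (g : G) (S : {set G}).

Lemma mem_bundle X j g : (g \in bundle X j) = (X g == j).
Proof. by rewrite inE. Qed.

Definition move X g (j : option 'I_n) : allocation n G :=
  [ffun x => if x == g then j else X x].

Lemma bundle_move X g j k :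
  bundle (move X g j) k = if k == j then g |: bundle X k else bundle X k :\ g.
Proof.
apply/setP => x; rewrite mem_bundle ffunE.
have [->|xg] := eqVneq x g; last first.
  by case: ifP; rewrite !inE (negPf xg).
by rewrite eq_sym; case: ifP; rewrite !inE eqxx.
Qed.

(** Double counting, by goods instead of bundles; the boolean on the right is coerced to nat. *)
Lemma sum_card_bundleI X S (K : pred 'I_n) :
  \sum_(j | K j) #|bundle X (Some j) :&: S| =
  \sum_(g in S) (if X g is Some k then K k else false).
Proof.
under eq_bigr => j _.
  rewrite -sum1_card (eq_bigl (fun g => (g \in S) && (X g == Some j))); last first.
    by move=> g; rewrite !inE andbC.
  rewrite big_mkcondr; over.
rewrite exchange_big /=; apply: eq_bigr => g _.
case: (X g) => [k|]; last by rewrite big1.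
rewrite -big_mkcondr /=; case Kk: (K k).
  rewrite (eq_bigl (pred1 k)) ?big_pred1_eq // => j.
  by rewrite /= (inj_eq Some_inj) eq_sym; have [->|] := eqVneq j k; rewrite ?Kk ?andbF.
rewrite big_pred0 // => j; rewrite (inj_eq Some_inj).
by have [<-|] := eqVneq k j; rewrite ?Kk ?andbF.
Qed.

Lemma sum_card_bundle X :
  \sum_(j < n) #|bundle X (Some j)| + #|bundle X None| = #|G|.
Proof.
under eq_bigr do rewrite -[bundle X _]setIT.
rewrite sum_card_bundleI -cardsT -[#|[set: G]|]sum1_card.
have -> : #|bundle X None| = \sum_(g in [set: G]) (X g == None).
  rewrite -sum1_card big_mkcond [RHS]big_mkcond; apply: eq_bigr => g _.
  by rewrite !inE; case: eqP.
by rewrite -big_split; apply: eq_bigr => g _; case: (X g).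
Qed.

Variables (R : realType) (c : R) (v : 'I_n -> {set G} -> R).
Local Notation r := (beta c v).
Local Notation edge := (exchange_edge c v).
Local Notation F := (F_set c v).
Hypothesis rkP : forall j, matroid_rank (r j).
Hypothesis rk_None : forall S, r None S = #|S|.

Definition clean X := [forall j, indep (r j) (bundle X j)].

Lemma cleanP X : reflect (forall j, r j (bundle X j) = #|bundle X j|) (clean X).
Proof. by apply: (iffP forallP) => h j; apply/eqP/h. Qed.

Lemma clean_Some X :
  (forall j, indep (r (Some j)) (bundle X (Some j))) -> clean X.
Proof. by move=> h; apply/forallP => -[j|]; [apply: h | apply/eqP/rk_None]. Qed.

(** Goods outside the sets [T j] become unallocated; disjointness of the new bundles is inherited
    from [X]. *)
Lemma clean_bundle (T : 'I_n -> {set G}) X :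
  (forall j, T j \subset bundle X (Some j)) ->
  (forall j, indep (r (Some j)) (T j)) ->
  exists2 Z, clean Z & forall j, bundle Z (Some j) = T j.
Proof.
move=> TX Ti; pose Z : allocation n G :=
  [ffun g => if X g is Some j then if g \in T j then Some j else None else None].
have ZT j : bundle Z (Some j) = T j.
  apply/setP => g; rewrite mem_bundle ffunE; apply/eqP/idP.
    by case: (X g) => // k; case: ifP => // gT [<-].
  by move=> gT; have := subsetP (TX j) g gT; rewrite mem_bundle => /eqP ->; rewrite gT.
by exists Z => //; apply: clean_Some => j; rewrite ZT.
Qed.

Definition clean_vector (a : 'I_n -> nat) :=
  exists2 X, clean X & forall j, #|bundle X (Some j)| = a j.

Lemma clean_vector_ext a a' : a =1 a' -> clean_vector a -> clean_vector a'.
Proof. by move=> e [X cX Xa]; exists X => // j; rewrite Xa. Qed.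

Lemma subset_card_ex S k : k <= #|S| -> exists2 T : {set G}, T \subset S & #|T| = k.
Proof.
move=> kS; exists [set x in take k (enum S)].
  by apply/subsetP => x; rewrite inE => /mem_take; rewrite mem_enum.
rewrite cardsE (card_uniqP _) ?take_uniq ?enum_uniq // size_takel //.
by rewrite -cardE.
Qed.

(** Subsets of independent sets are independent, so bundles can be thinned to any smaller sizes. *)
Lemma clean_vector_le a a' :
  (forall j, a j <= a' j) -> clean_vector a' -> clean_vector a.
Proof.
move=> aa' [X /forallP cX Xa'].
have /fin_all_exists2[T TX Ta] j :
    exists2 T : {set G}, T \subset bundle X (Some j) & #|T| = a j.
  by apply: subset_card_ex; rewrite Xa'.
have [Z cZ ZT] := clean_bundle TX (fun j => indepS (rkP _) (TX j) (cX (Some j))).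
by exists Z => // j; rewrite ZT.
Qed.

(** * The exchange graph of a clean allocation *)

Lemma exchange_edgeE X g g' : clean X ->
  edge X g g' =
  (r (X g) (g' |: (bundle X (X g) :\ g)) == #|bundle X (X g)|).
Proof.
move=> /cleanP cX; apply/existsP/idP => [[j]|h].
  by rewrite mem_bundle => /andP[/eqP <-]; rewrite cX.
by exists (X g); rewrite mem_bundle eqxx cX.
Qed.

Lemma in_F_set X i g : clean X ->
  (g \in F X i) = (r (Some i) (g |: bundle X (Some i)) != #|bundle X (Some i)|).
Proof.
move=> /cleanP /(_ (Some i)) cX; rewrite inE addn1.
case: (rkP (Some i)) => _ /(_ (bundle X (Some i)) g) /andP[].
by rewrite cX => h1 h2 _; apply/idP/idP; lia.
Qed.

(** With [j] the owner of [g], the set [X_j - g] is independent of size [|X_j| - 1]; adding [g']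
    either restores the rank, which is an edge, or leaves it unchanged. *)
Lemma not_edge_span X g g' : clean X -> ~~ edge X g g' ->
  r (X g) (g' |: (bundle X (X g) :\ g)) = r (X g) (bundle X (X g) :\ g).
Proof.
move=> cX; rewrite exchange_edgeE // => ne.
have : indep (r (X g)) (bundle X (X g) :\ g).
  by apply: (indepS (rkP _) (subsetDl _ _)); apply: (forallP cX).
move=> /eqP iXg; have gX : g \in bundle X (X g) by rewrite mem_bundle.
have := cardsD1 g (bundle X (X g)); rewrite gX => e; rewrite e -iXg in ne.
case: (rkP (X g)) => _ /(_ (bundle X (X g) :\ g) g') /andP[h1 h2] _; lia.
Qed.

(* S is the set of goods reachable from F_i(X).  Agent i, as well as every
   agent j holding a good of S, has all the goods outside S in the span of
   X_j \ S, so that |Z_j \ S| <= |X_j \ S|. *)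
Lemma closed_card_le X Z i S : clean X -> clean Z ->
  F X i \subset S ->
  (forall g g', g \in S -> edge X g g' -> g' \in S) ->
  (forall g, g \in S -> exists2 j, X g = Some j &
     #|bundle X (Some j)| <= #|bundle Z (Some j)|) ->
  #|bundle Z (Some i)| <= #|bundle X (Some i)|.
Proof.
move=> cX cZ FS eS XS.
pose K := [pred j | (j == i) || (bundle X (Some j) :&: S != set0)].
have Kspan j z : K j -> z \notin S ->
    r (Some j) (z |: (bundle X (Some j) :\: S)) = r (Some j) (bundle X (Some j) :\: S).
  move=> Kj zS; have nspan g : g \in bundle X (Some j) :&: S ->
      r (Some j) (z |: (bundle X (Some j) :\ g)) = r (Some j) (bundle X (Some j) :\ g).
    rewrite !inE => /andP[/eqP <- gS]; apply: not_edge_span => //.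
    by apply: contra zS; apply: eS.
  apply: rank_span_setD => //; first exact: (forallP cX).
  case/orP: Kj => [/eqP ->|/set0Pn[g gX]].
    apply/eqP; rewrite (cleanP _ cX); apply: contraR zS => zF.
    by apply: (subsetP FS); rewrite in_F_set.
  exact: rank_span (subsetDl _ _) (nspan g gX).
have Kle j : K j -> #|bundle Z (Some j) :\: S| <= #|bundle X (Some j) :\: S|.
  move=> Kj; have ind W : clean W ->
      #|bundle W (Some j) :\: S| = r (Some j) (bundle W (Some j) :\: S).
    move=> cW; apply/esym/eqP/(indepS (rkP _) (subsetDl _ _)).
    exact: (forallP cW).
  rewrite !ind //.
  rewrite -[leqRHS](rank_span_set (rkP (Some j)) (D := bundle Z (Some j) :\: S)).
    exact: rank_mono (subsetUl _ _).
  by move=> z; rewrite inE => /andP[zS _]; apply: Kspan.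
have Ki : K i by rewrite /= eqxx.
have le : \sum_(j | K j) #|bundle Z (Some j)| <= \sum_(j | K j) #|bundle X (Some j)|.
  under eq_bigr do rewrite -(cardsID S).
  under [leqRHS]eq_bigr do rewrite -(cardsID S).
  rewrite !big_split /=; apply: leq_add; last exact: leq_sum.
  (* In [X] every good of [S] is held by an agent of [K], so within [S] these agents jointly hold at
     least as much in [X] as in [Z]. *)
  rewrite !sum_card_bundleI; apply: leq_sum => g gS.
  have [j Xg _] := XS g gS; rewrite Xg.
  have -> : (j == i) || (bundle X (Some j) :&: S != set0).
    by apply/orP; right; apply/set0Pn; exists g; rewrite inE mem_bundle Xg eqxx.
  by case: (Z g) => // k; case: (_ || _).
(* The other agents of [K] hold no more in [X] than in [Z], so the inequality of the sums passes to
   [i] alone. *)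
move: le; rewrite (bigD1 i) //= [leqRHS](bigD1 i) //=.
have : \sum_(j | K j && (j != i)) #|bundle X (Some j)|
    <= \sum_(j | K j && (j != i)) #|bundle Z (Some j)|.
  apply: leq_sum => j /andP[/orP[/eqP ->|/set0Pn[g]]]; first by rewrite eqxx.
  rewrite !inE => /andP[/eqP Xg gS] _; have [k] := XS g gS.
  by rewrite Xg => -[->].
rewrite /=; lia.
Qed.

(* The list p is the path read backwards. *)
Fixpoint chordless X i (p : seq G) : bool :=
  match p with
  | [::] => false
  | z :: q => match q with
    | [::] => z \in F X i
    | y :: q' => [&& edge X y z, all (fun x => ~~ edge X x z) q',
                     z \notin F X i & chordless X i q]
    end
  end.

Lemma chordless_cons X i z y q : chordless X i [:: z, y & q] =
  [&& edge X y z, all (fun x => ~~ edge X x z) q, z \notin F X i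
    & chordless X i (y :: q)].
Proof. by []. Qed.

(** The head of the list is only ever the target of an edge, so agreement on the edges leaving the
    tail is enough. *)
Lemma eq_chordless X Z i y q :
  F X i = F Z i -> (forall x w, x \in q -> edge X x w = edge Z x w) ->
  chordless X i (y :: q) = chordless Z i (y :: q).
Proof.
move=> eF; elim: q y => [|x q IH] y e; first by rewrite /= eF.
rewrite !chordless_cons eF e ?mem_head //; congr [&& _, _, _ & _].
  by apply: eq_in_all => w wq; rewrite e // inE wq orbT.
by apply: IH => w w' wq; apply: e; rewrite inE wq orbT.
Qed.

Lemma transfer1 X i z : transfer X i [:: z] = move X z (Some i).
Proof. by apply/ffunP => x; rewrite !ffunE inE /= eq_sym; case: eqP. Qed.

(** The last shift can be made first: [z] goes to the owner of [y], and [y] becomes unallocated, as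
    the end of the shortened path. This drives the induction on paths. *)
Lemma transfer_rcons X i z y q : uniq (z :: y :: q) ->
  transfer X i (rev (z :: y :: q)) =
  transfer (move (move X z (X y)) y None) i (rev (y :: q)).
Proof.
move=> /and3P[]; rewrite inE negb_or => /andP[zy zq] yq uq.
apply/ffunP => g; rewrite !ffunE (rev_cons z) mem_rcons inE.
have [->{g}|gz] /= := eqVneq g z.
  rewrite mem_rev inE (negPf zy) (negPf zq) /= -cats1 index_cat mem_rev inE.
  rewrite (negPf zy) (negPf zq) /= eqxx addn0 size_rev /= map_cat rev_cons.
  rewrite nth_cat size_map size_rcons size_rev ltnSn.
  by rewrite map_rcons nth_rcons size_map size_rev ltnn eqxx.
have [gyq|gyq] := ifPn; last first.
  by move: gyq; rewrite mem_rev inE negb_or => /andP[/negPf -> _].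
rewrite -cats1 index_cat gyq.
rewrite rev_cons -cats1 -catA !map_cat -!cat_cons !nth_cat /= !size_map.
have lt : index g (rev q ++ [:: y]) < (size (rev q)).+1.
  by rewrite -(size_rcons _ y) cats1 index_mem -rev_cons.
rewrite !lt; congr (nth _ (_ :: _) _); apply/eq_in_map => x.
rewrite mem_rev !ffunE => xq.
by have [e|_] := eqVneq x y; [rewrite -e xq in yq
  | have [e|//] := eqVneq x z; rewrite -e xq in zq].
Qed.

Lemma cardsU1D1 S y z : y \in S -> z \notin S -> #|z |: (S :\ y)| = #|S|.
Proof. by move=> yS zS; rewrite cardsU1 !inE (negPf zS) andbF (cardsD1 y S) yS. Qed.

(* Shifting the last edge y -> z of a chordless path gives a clean allocation
   with the same bundle sizes, in which the path without z is chordless. *)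
Lemma transfer_chordless X i z q :
  clean X -> chordless X i (z :: q) -> uniq (z :: q) -> X z = None ->
  all (fun x => X x != None) q ->
  [/\ clean (transfer X i (rev (z :: q))),
      forall j, #|bundle (transfer X i (rev (z :: q))) (Some j)|
                = #|bundle X (Some j)| + (j == i)
    & bundle (transfer X i (rev (z :: q))) None = bundle X None :\ z].
Proof.
elim: q X z => [|y q IH] X z cX.
  rewrite /= => zF _ Xz _; rewrite [rev _]/= transfer1.
  have zX j : z \notin bundle X (Some j) by rewrite mem_bundle Xz.
  have XD j : bundle X (Some j) :\ z = bundle X (Some j).
    by rewrite setD1_notin.
  split; last by rewrite bundle_move.
    apply: clean_Some => j; rewrite bundle_move XD (inj_eq Some_inj).
    case: eqP => [->|_]; last exact: (forallP cX).
    by rewrite rank_setU1_indep ?(forallP cX) // (cleanP _ cX) -in_F_set.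
  move=> j; rewrite bundle_move XD (inj_eq Some_inj).
  by case: eqP => [->|_]; rewrite ?addn0 // cardsU1 zX addnC.
move=> ch U Xz /= /andP[Xy Xq].
move: ch; rewrite chordless_cons => /and4P[eyz nch zF chy].
rewrite transfer_rcons //; set X1 := move _ y None.
move: U; rewrite cons_uniq => /andP[]; rewrite inE negb_or => /andP[zy zq] uyq.
have /andP[yq uq] : (y \notin q) && uniq q by [].
have zX j : j != None -> z \notin bundle X j by rewrite mem_bundle Xz eq_sym.
have X1None : bundle X1 None = y |: (bundle X None :\ z).
  by rewrite bundle_move eqxx bundle_move eq_sym (negPf Xy).
have X1E j : j != None -> bundle X1 j =
    if j == X y then z |: (bundle X j :\ y) else bundle X j.
  move=> j0; rewrite bundle_move (negPf j0) bundle_move.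
  have [->|jy] := eqVneq j (X y).
    by apply/setP => x; rewrite !inE; have [->|] := eqVneq x z; rewrite ?zy.
  have yj : y \notin bundle X j by rewrite mem_bundle eq_sym.
  apply/setP => x; rewrite !inE; have [->|_] := eqVneq x y.
    by move: yj; rewrite mem_bundle => /negPf ->.
  have [->|_//] := eqVneq x z.
  by move: (zX j j0); rewrite mem_bundle => /negPf ->.
have yX : y \in bundle X (X y) by rewrite mem_bundle.
have eyz' : r (X y) (z |: (bundle X (X y) :\ y)) = #|bundle X (X y)|.
  by apply/eqP; rewrite -exchange_edgeE.
have cX1 : clean X1.
  apply: clean_Some => j; rewrite X1E //.
  case: eqP => [->|_]; last exact: (forallP cX).
  by rewrite /indep eyz' cardsU1D1 ?zX.
(* Replacing [y] by [z] keeps the span of [B] if [z] is already spanned. This is used with the whole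
   bundle for [F_set], and with the bundle minus [x] for the edges leaving [x]. *)
have exch (W B : {set G}) : B \subset bundle X (X y) -> y \in B ->
    r (X y) (z |: B) = r (X y) B ->
    r (X y) (W :|: (z |: (B :\ y))) = r (X y) (W :|: B).
  move=> BX yB zB; apply: rank_exchange => //.
  have i1 : indep (r (X y)) (z |: (B :\ y)).
    apply: (@indepS _ _ (rkP _) _ (z |: (bundle X (X y) :\ y))).
      by rewrite setUS // setSD.
    by rewrite /indep eyz' cardsU1D1 ?zX.
  have i2 : indep (r (X y)) B by apply: indepS BX _; rewrite // (forallP cX).
  have zB' : z \notin B by apply: contra (zX _ Xy) => /(subsetP BX).
  by rewrite (eqP i1) (eqP i2) cardsU1D1.
have eF : F X1 i = F X i.
  apply/setP => w; rewrite !in_F_set // X1E //.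
  have [e|//] := eqVneq (Some i) (X y); rewrite e cardsU1D1 ?zX // exch //.
  by apply/eqP; rewrite (cleanP _ cX) -e; move: zF; rewrite in_F_set // negbK.
have eE x w : x \in q -> edge X1 x w = edge X x w.
  move=> xq; have xz : x != z by apply: contraNneq zq => <-.
  have xy : x != y by apply: contraNneq yq => <-.
  rewrite !exchange_edgeE //.
  have -> : X1 x = X x by rewrite !ffunE (negPf xy) (negPf xz).
  rewrite X1E ?(allP Xq) //.
  have [e|//] := eqVneq (X x) (X y); rewrite e cardsU1D1 ?zX //.
  have -> : (z |: bundle X (X y) :\ y) :\ x = z |: ((bundle X (X y) :\ x) :\ y).
    apply/setP => t; rewrite !inE; have [->|] := eqVneq t x; first by rewrite (negPf xz) andbF.
    by [].
  rewrite exch ?subsetDl // ?inE ?(eq_sym y) ?xy ?eqxx //.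
  by rewrite -e; apply: not_edge_span => //; apply: (allP nch).
have [||||h1 h2 h3] := IH X1 y cX1 => //.
- by rewrite (eq_chordless y eF eE).
- by rewrite ffunE eqxx.
- apply/allP => x xq; rewrite !ffunE.
  have [e|_] := eqVneq x y; first by rewrite -e xq in yq.
  by have [e|_] := eqVneq x z; [rewrite -e xq in zq | apply: (allP Xq)].
split=> // [j|].
  rewrite h2 X1E //; have [->|//] := eqVneq (Some j) (X y); rewrite cardsU1D1 ?zX //.
by rewrite h3 X1None setU1K // !inE negb_and Xy orbT.
Qed.

(** * Shortest paths, augmentation and exchange of clean vectors *)

Lemma transfer_path_cat X i p1 x p2 :
  transfer_path c v X i (p1 ++ x :: p2) =
  [&& if p1 is g :: q then (g \in F X i) && path (edge X) g (rcons q x)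
      else x \in F X i, path (edge X) x p2 & last x p2 \in bundle X None].
Proof.
case: p1 => [//|g q] /=.
by rewrite cat_path last_cat rcons_path /= -!andbA.
Qed.

(** A repeated vertex, a chord, a later vertex in [F_set] or an earlier unallocated one would each
    allow a segment to be cut out, giving a shorter path. *)
Lemma shortest_transfer_chordless X i p : shortest_transfer_path c v X i p ->
  exists z q, [/\ p = rev (z :: q), chordless X i (z :: q), uniq (z :: q),
    X z = None & all (fun x => X x != None) q].
Proof.
move=> [tp short].
have cut_last p1 x p2 : p = p1 ++ x :: p2 -> X x = None -> p2 = [::].
  move=> e Xx; move: tp; rewrite e transfer_path_cat => /and3P[h1 h2 _].
  have /short : transfer_path c v X i (p1 ++ [:: x]).
    by rewrite transfer_path_cat h1 /= mem_bundle Xx.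
  by rewrite e !size_cat /=; case: p2 {e h2} => //= ? ?; lia.
have cut_head p1 x p2 : p = p1 ++ x :: p2 -> x \in F X i -> p1 = [::].
  move=> e Xx; move: tp; rewrite e transfer_path_cat => /and3P[_ h2 h3].
  have /short : transfer_path c v X i (x :: p2) by rewrite /= Xx h2.
  by rewrite e !size_cat /=; case: p1 {e} => //= ? ?; lia.
have cut_edge p1 x p2 y p3 : p = p1 ++ x :: p2 ++ y :: p3 -> edge X x y -> p2 = [::].
  move=> e exy; move: tp; rewrite e transfer_path_cat cat_path last_cat /=.
  move=> /and3P[h1 /and3P[_ _ h2] h3].
  have /short : transfer_path c v X i (p1 ++ x :: y :: p3).
    by rewrite transfer_path_cat h1 /= exy h2.
  by rewrite e !size_cat /= !size_cat /=; case: p2 {e h3} => //= ? ?; lia.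
have cut_loop p1 x p2 p3 : p <> p1 ++ x :: p2 ++ x :: p3.
  move=> e; move: tp; rewrite e transfer_path_cat cat_path last_cat /=.
  move=> /and3P[h1 /and3P[_ _ h2] h3].
  have /short : transfer_path c v X i (p1 ++ x :: p3).
    by rewrite transfer_path_cat h1 h2.
  by rewrite e !size_cat /= !size_cat /=; lia.
(* The induction is on prefixes because reversal puts the end of a prefix at the head of the list,
   where [chordless] recurses. *)
have chord p1 p2 : p1 != [::] -> p = p1 ++ p2 -> chordless X i (rev p1).
  elim/last_ind: p1 p2 => // p1 z IH p2 _.
  case/lastP: p1 IH => [_ e|p1 y IH]; first by move: tp; rewrite e => /andP[].
  move=> e0; have e : p = p1 ++ y :: z :: p2 by rewrite e0 -!cats1 -!catA.
  have e' : p = (p1 ++ [:: y]) ++ z :: p2 by rewrite -catA.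
  rewrite !rev_rcons chordless_cons; apply/and4P; split.
  - by move: tp; rewrite e transfer_path_cat => /and3P[_ /andP[]].
  - apply/allP => x; rewrite mem_rev => xp; apply/negP => exz.
    case/splitPr: xp e => a b e.
    suff : rcons b y = [::] by case: (b).
    apply: (cut_edge a x _ z p2) exz.
    by rewrite e -cats1 -!catA.
  - by apply/negP => /(cut_head _ _ _ e'); case: (p1).
  - have := IH (z :: p2); rewrite rev_rcons -cats1 -catA; apply=> //.
    by rewrite cats1; case: (p1).
have p0 : p <> [::] by move=> e; move: tp; rewrite e.
case/lastP: p p0 tp short cut_last cut_head cut_edge cut_loop chord => // q z.
move=> _ tp _ cut_last _ _ cut_loop chord.
exists z, (rev q); split.
- by rewrite rev_cons revK.
- by rewrite -rev_rcons; apply: (chord _ [::]); [case: (q) | rewrite cats0].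
- rewrite -rev_rcons rev_uniq; apply: contraT => /uniqPn -/(_ z)[i1 [i2 [lt12 lt2 e]]].
  set s := rcons q z in cut_loop lt2 e.
  have lt1 := ltn_trans lt12 lt2.
  exfalso; apply: (cut_loop (take i1 s) (nth z s i1)
     (take (i2 - i1.+1) (drop i1.+1 s)) (drop i2.+1 s)).
  have {2}-> : nth z s i1 = nth z (drop i1.+1 s) (i2 - i1.+1).
    by rewrite nth_drop subnKC.
  have -> : drop i2.+1 s = drop (i2 - i1.+1).+1 (drop i1.+1 s).
    by rewrite drop_drop; congr (drop _ _); lia.
  rewrite -(drop_nth z (s := drop i1.+1 s)); last by rewrite size_drop ltn_sub2r ?(leq_ltn_trans lt12).
  by rewrite cat_take_drop -drop_nth // cat_take_drop.
- move: tp; rewrite -cats1 transfer_path_cat /= mem_bundle => /andP[_].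
  by move=> /eqP.
- apply/allP => x; rewrite mem_rev => xq; apply/negP => /eqP Xx.
  case/splitPr: xq cut_last => a b cut_last.
  have := cut_last a x (rcons b z); rewrite -cats1 -catA /= cats1 => /(_ erefl Xx).
  by case: (b).
Qed.

Lemma shortest_transfer_clean X i p :
  clean X -> shortest_transfer_path c v X i p ->
  [/\ clean (transfer X i p),
      forall j, #|bundle (transfer X i p) (Some j)|
                = #|bundle X (Some j)| + (j == i)
    & forall g q, p = g :: q ->
        X (last g q) = None /\
        bundle (transfer X i p) None = bundle X None :\ last g q].
Proof.
move=> cX /shortest_transfer_chordless[z [q [-> ch uq Xz Xq]]].
have [h1 h2 h3] := transfer_chordless cX ch uq Xz Xq.
split=> // g q' e; have -> : last g q' = z.
  have := congr1 (last g) e; rewrite /= => <-.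
  by rewrite rev_cons last_rcons.
by rewrite Xz h3.
Qed.

Lemma shortest_transfer_ex X i p : transfer_path c v X i p ->
  exists p', shortest_transfer_path c v X i p'.
Proof.
(* Tuples of length [k] form a finite type, so the existence of a path of length [k] is decidable
   and a least length can be taken. *)
move=> tp; pose Q k := [exists t : k.-tuple G, transfer_path c v X i t].
have exQ : exists k, Q k by exists (size p); apply/existsP; exists (in_tuple p).
case: (ex_minnP exQ) => k /existsP[t tpt] mint; exists t; split=> // p' tp'.
by rewrite size_tuple; apply: mint; apply/existsP; exists (in_tuple p').
Qed.

Lemma transfer_path_vector X i p : clean X -> transfer_path c v X i p ->
  clean_vector (fun j => #|bundle X (Some j)| + (j == i)).
Proof.
move=> cX /shortest_transfer_ex[p' /(shortest_transfer_clean cX)[h1 h2 _]].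
by exists (transfer X i p').
Qed.

(** The set of goods reachable from [F_set X i] is closed and contains no unallocated good, so
    [closed_card_le] rules out a clean [Z] that gives [i] more and nobody less. *)
Lemma no_transfer_path_vector X i : clean X ->
  (forall p, ~~ transfer_path c v X i p) ->
  ~ clean_vector (fun j => #|bundle X (Some j)| + (j == i)).
Proof.
move=> cX nop [Z cZ Zc].
suff : #|bundle Z (Some i)| <= #|bundle X (Some i)| by rewrite Zc eqxx; lia.
apply: (@closed_card_le _ _ _ [set g | [exists g0 in F X i, connect (edge X) g0 g]]) => //.
- by apply/subsetP => g gF; rewrite inE; apply/exists_inP; exists g.
- move=> g g'; rewrite !inE => /exists_inP[g0 g0F g0g] e.
  by apply/exists_inP; exists g0 => //; apply: connect_trans g0g (connect1 e).
move=> g; rewrite inE => /exists_inP[g0 g0F /connectP[p pp lp]].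
case Xg: (X g) => [j|]; first by exists j => //; rewrite Zc leq_addr.
by have := nop (g0 :: p); rewrite /= g0F pp -lp mem_bundle Xg.
Qed.

(** The search from [F_set X i] continues only through goods whose owner holds no more in [X] than
    in [Z]. By [closed_card_le] it must meet an unallocated good, which augments, or a good of some
    [k] holding more in [X] than in [Z]. *)
Lemma clean_vector_exchange X Z i : clean X -> clean Z ->
  #|bundle X (Some i)| < #|bundle Z (Some i)| ->
  clean_vector (fun j => #|bundle X (Some j)| + (j == i)) \/
  exists k, [/\ k != i, #|bundle Z (Some k)| < #|bundle X (Some k)| &
    clean_vector (fun j => #|bundle X (Some j)| + (j == i) - (j == k))].
Proof.
move=> cX cZ ltXZ.
pose ok g := if X g is Some j then #|bundle X (Some j)| <= #|bundle Z (Some j)| else false.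
pose e := [rel g g' | ok g && edge X g g'].
pose S := [set g | [exists g0 in F X i, connect e g0 g]].
have [okS|] := boolP [forall g in S, ok g].
  suff : #|bundle Z (Some i)| <= #|bundle X (Some i)| by rewrite leqNgt ltXZ.
  apply: (@closed_card_le _ _ _ S) => //.
  - by apply/subsetP => g gF; rewrite inE; apply/exists_inP; exists g.
  - move=> g g' gS egg'; have okg := forall_inP okS g gS.
    move: gS; rewrite !inE => /exists_inP[g0 g0F g0g].
    apply/exists_inP; exists g0 => //; apply: connect_trans g0g (connect1 _).
    by rewrite /= okg.
  move=> g /(forall_inP okS); rewrite /ok; case: (X g) => // j h; by exists j.
rewrite negb_forall_in => /exists_inP[g]; rewrite inE => /exists_inP[g0 g0F].
move=> /connectP[p pp lp]; rewrite /ok; case Xg: (X g) => [k|] => [|_]; last first.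
  left; apply: (@transfer_path_vector _ _ (g0 :: p)) => //.
  rewrite /= g0F -lp mem_bundle Xg eqxx andbT.
  by apply: sub_path pp => x y /andP[].
rewrite -ltnNge => ltk; right; exists k.
have ki : k != i by apply: contraTneq ltk => ->; rewrite -leqNgt ltnW.
(* Discarding [g] makes the path end in bundle 0. Its edges leave goods of agents other than [k],
   whose bundles are unchanged, so it remains a path. *)
split=> //; pose X' := move X g None.
have X'E j : bundle X' (Some j) = bundle X (Some j) :\ g by rewrite bundle_move.
have X'D j : j != k -> bundle X' (Some j) = bundle X (Some j).
  move=> jk; rewrite X'E setD1_notin //.
  by rewrite mem_bundle Xg (inj_eq Some_inj) eq_sym.
have cX' : clean X'.
  apply: clean_Some => j; rewrite X'E; apply: (indepS (rkP _) (subsetDl _ _)).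
  exact: (forallP cX).
have X'c j : #|bundle X' (Some j)| = #|bundle X (Some j)| - (j == k).
  have [->|jk] := eqVneq j k; last by rewrite X'D // subn0.
  by rewrite X'E [in RHS](cardsD1 g) mem_bundle Xg eqxx addKn.
have ik : i != k by rewrite eq_sym.
have X'F : F X' i = F X i by apply/setP => w; rewrite !in_F_set // X'D.
apply: (@clean_vector_ext (fun j => #|bundle X' (Some j)| + (j == i))).
  move=> j; rewrite X'c; have [->|_] := eqVneq j i; last by rewrite !addn0.
  by rewrite (negPf ik) !subn0.
apply: (@transfer_path_vector _ _ (g0 :: p)) => //.
rewrite /= X'F g0F -lp mem_bundle ffunE !eqxx andbT /=.
apply: sub_path pp => x y /andP[okx]; rewrite !exchange_edgeE //.
move: okx; rewrite /ok; case Xx: (X x) => [j|//] lej.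
have xg : x != g by apply: contraTneq lej => xg; move: Xx; rewrite xg Xg => -[<-]; rewrite -ltnNge.
have jk : j != k by apply: contraTneq lej => ->; rewrite -ltnNge.
by rewrite ffunE (negPf xg) Xx X'D.
Qed.

End Allocations.

(** * Bivalued submodular valuations as matroid ranks *)

Section Valuations.

Variables (R : realType) (G : finType) (c : nat).
Hypothesis c_ge2 : (2 <= c)%N.

(** When [S] is built good by good, [r S] counts the marginals equal to [c]. Since [c - 1 > 0], the
    value determines this count, and diminishing marginals pass from [v] to [r]. *)
Lemma one_c_SUB_rank (v : {set G} -> R) : one_c_SUB c%:R v ->
  exists2 r, matroid_rank r & forall S, v S = (#|S| + c.-1 * r S)%:R.
Proof.
case=> v0 v1c vsub.
have ex S : exists k, v S == (#|S| + c.-1 * k)%:R.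
  elim/setU1_ind: S => [|g S gS [k /eqP e]].
    by exists 0%N; rewrite v0 cards0 muln0.
  rewrite cardsU1 gS; have [] := v1c S g gS; rewrite /marginal e => /eqP.
    rewrite subr_eq => /eqP ->; exists k.
    by apply/eqP; rewrite -addnA [RHS]natrD.
  rewrite subr_eq => /eqP ->; exists k.+1.
  by rewrite -natrD eqr_nat mulnS; apply/eqP; lia.
pose r S : nat := xchoose (ex S); have rE S : v S = (#|S| + c.-1 * r S)%:R.
  exact/eqP/(xchooseP (ex S)).
exists r => //; have c1 : (0 < c.-1)%N by case: (c) c_ge2 => [|[]].
have step (S : {set G}) g : g \notin S -> r (g |: S) = r S \/ r (g |: S) = (r S).+1.
  move=> gS; have [] := v1c S g gS; rewrite /marginal !rE cardsU1 gS => /eqP.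
    by rewrite subr_eq -[1]/(1%:R) -natrD eqr_nat => h; left; nia.
  by rewrite subr_eq -natrD eqr_nat => h; right; nia.
split.
- have := rE set0; rewrite v0 cards0 => /eqP; rewrite eq_sym pnatr_eq0; nia.
- move=> S g; have [gS|gS] := boolP (g \in S).
    by rewrite (setUidPr _) ?sub1set // leqnn leqnSn.
  by case: (step S g gS) => ->; rewrite ?leqnn ?leqnSn.
move=> S T g ST; have [gT|gT] := boolP (g \in T).
  rewrite (setUidPr (_ : [set g] \subset T)) ?sub1set // [leqRHS]addnC leq_add2l.
  have [gS|gS] := boolP (g \in S); first by rewrite (setUidPr _) ?sub1set.
  by case: (step S g gS) => ->; rewrite ?leqnn ?leqnSn.
have gS : g \notin S by apply: contra gT => /(subsetP ST).
have := vsub S T g ST gT; rewrite /marginal !rE !cardsU1 gS gT.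
rewrite lerBlDr addrAC lerBrDr -!natrD ler_nat; nia.
Qed.

Variables (n : nat) (v : 'I_n -> {set G} -> R).

Lemma beta_None S : beta c%:R v None S = #|S|.
Proof.
apply/eqP; rewrite eqn_leq; apply/andP; split.
  by apply/bigmax_leqP => T /andP[TS _]; apply: subset_leq_card.
by apply: leq_bigmax_cond; rewrite subxx /= /dummy_val eqxx.
Qed.

(** The equation [v_i(T) = c|T|] characterizes the independent sets [T], so [beta] is the largest
    size of an independent subset, attained by a basis. *)
Lemma beta_rank i r : matroid_rank r ->
  (forall S, v i S = (#|S| + c.-1 * r S)%:R) -> beta c%:R v (Some i) =1 r.
Proof.
move=> rP vE S.
have vr T : (v i T == c%:R * #|T|%:R) = indep r T.
  rewrite vE -natrM eqr_nat /indep; have : (0 < c.-1)%N by case: (c) c_ge2 => [|[]].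
  move=> h; apply/idP/idP; nia.
apply/eqP; rewrite eqn_leq; apply/andP; split.
  apply/bigmax_leqP => T; rewrite /= vr => /andP[TS /eqP <-].
  exact: rank_mono TS.
have [T TS [iT <-]] := basis_ex rP S.
by apply: leq_bigmax_cond; rewrite TS /= vr.
Qed.

Lemma beta_matroid i : one_c_SUB c%:R (v i) ->
  matroid_rank (beta c%:R v (Some i)) /\
  forall S, v i S = (#|S| + c.-1 * beta c%:R v (Some i) S)%:R.
Proof.
move=> /one_c_SUB_rank[r rP vE]; have e := beta_rank rP vE.
split=> [|S]; last by rewrite e.
by case: rP => r0 r1 rs; split=> *; rewrite !e; auto.
Qed.

End Valuations.

(** * Weighted welfare and its exchange inequalities *)

Section Welfare.

Variables (R : realType) (M : R) (c : nat).
Hypotheses (M_gt2 : 2 < M) (c_ge2 : (2 <= c)%N).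

(* With weight 1/M for zero utility, nash_gain v M X i d is the ratio
   weight (v_i(X_i) + d) / weight (v_i(X_i)). *)
Definition weight (u : nat) : R := if u == 0%N then M^-1 else u%:R.

Lemma M_gt0 : 0 < M. Proof. by have := M_gt2; lra. Qed.

Lemma weight_gt0 u : 0 < weight u.
Proof.
rewrite /weight; have [_|u0] := posnP u; last by rewrite ltr0n.
by rewrite invr_gt0 M_gt0.
Qed.

Lemma weight0 : weight 0 = M^-1. Proof. by []. Qed.
Lemma weightS u : weight u.+1 = u.+1%:R. Proof. by []. Qed.
Lemma weight_pos u : (0 < u)%N -> weight u = u%:R. Proof. by case: u. Qed.

Lemma weight_mono x y : (x <= y)%N -> weight x <= weight y.
Proof.
case: x => [|x]; case: y => [|y] // h; last by rewrite !weightS ler_nat.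
rewrite weight0 weightS; apply: (@le_trans _ _ 1); last by rewrite ler1n.
by rewrite invf_le1 ?M_gt0 //; have := M_gt2; lra.
Qed.

(** For positive [x], [pq - xy = (p - x)(q - x)]. For [x = 0] and positive [p], [q], the bound is
    [p + q <= 2pq <= M pq]. *)
Lemma weight_balance x y p q : (x <= p)%N -> (x <= q)%N -> (p + q = x + y)%N ->
  weight x * weight y <= weight p * weight q.
Proof.
case: x => [|x]; last first.
  move=> xp xq e.
  rewrite !weight_pos //; [|lia..].
  have -> : y = (p - x.+1 + q)%N by lia.
  rewrite -!natrM ler_nat -{2}(subnKC xp) mulnDr mulnDl addnC leq_add2l mulnC.
  by rewrite leq_mul2l xq orbT.
case: p => [|p] _; case: q => [|q] _; rewrite ?add0n ?addn0 => <- //.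
  by rewrite mulrC.
rewrite weight0 !weight_pos // ler_pdivrMl; last exact: M_gt0.
apply: (@le_trans _ _ (2 * (p.+1%:R * q.+1%:R))).
  by rewrite -!natrM ler_nat; nia.
by rewrite ler_wpM2r ?ltW // -natrM ltr0n.
Qed.

(** For positive [a], expanding leaves [c a <= c s]; the zero cases use [M > 2]. *)
Lemma weight_c_one a s : (a <= s)%N ->
  weight (c * a) * weight s.+1 <= weight (c * a + c) * weight s.
Proof.
case: a => [_|a as_]; last first.
  have s0 : (0 < s)%N by lia.
  rewrite !weight_pos //; [|lia..].
  by rewrite -!natrM ler_nat; nia.
rewrite muln0 add0n weight0 (weight_pos (ltnW c_ge2)) weightS ler_pdivrMl; last exact: M_gt0.
case: s => [|s].
  by rewrite weight0 mulrCA divff ?gt_eqF ?M_gt0 // mulr1 ler_nat ltnW.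
rewrite weightS; apply: (@le_trans _ _ (2 * (c%:R * s.+1%:R))).
  by rewrite -!natrM ler_nat; nia.
by rewrite ler_wpM2r ?ltW // -natrM ltr0n; nia.
Qed.

(** For positive [u], expanding leaves [c u <= c k]. Strictness matters at [u = 0]: it gives
    [k >= 1], hence [c k + c <= 2 c k <= M c k]. *)
Lemma weight_one_c u k : (u < k)%N ->
  weight u * weight (c * k + c) <= weight u.+1 * weight (c * k).
Proof.
move=> uk; rewrite weightS.
have h : (0 < c * k)%N by nia.
have h' : (0 < c * k + c)%N by nia.
rewrite (weight_pos h) (weight_pos h'); case: u uk => [|u] uk.
  rewrite weight0 mul1r ler_pdivrMl; last exact: M_gt0.
  apply: (@le_trans _ _ (2 * (c * k)%:R)); first by rewrite -natrM ler_nat; nia.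
  by rewrite ler_wpM2r ?ltW // ltr0n.
by rewrite weightS -!natrM ler_nat; nia.
Qed.

Variable n : nat.
Implicit Types (a b u : 'I_n -> nat) (i k : 'I_n).

Definition welfare u : R := \prod_k weight (u k).

Lemma welfare_le1 u u' i : (forall j, j != i -> u' j = u j) ->
  (u i <= u' i)%N -> welfare u <= welfare u'.
Proof.
move=> e le; apply: ler_prod => j _; rewrite ltW ?weight_gt0 //=.
by apply: weight_mono; have [->//|/e ->] := eqVneq j i.
Qed.

Lemma bigD2 (T : Type) (idx : T) (op : Monoid.com_law idx) (f : 'I_n -> T) i k :
  i != k -> \big[op/idx]_j f j =
    op (f i) (op (f k) (\big[op/idx]_(j | (j != i) && (j != k)) f j)).
Proof. by move=> ik; rewrite (bigD1 i) //= (bigD1 k) //= eq_sym. Qed.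

Lemma welfare_le2 u u' i k : i != k ->
  (forall j, j != i -> j != k -> u' j = u j) ->
  weight (u i) * weight (u k) <= weight (u' i) * weight (u' k) ->
  welfare u <= welfare u'.
Proof.
move=> ik e le; rewrite /welfare !(bigD2 _ _ ik) /= !mulrA.
have -> : \prod_(j < n | (j != i) && (j != k)) weight (u' j) =
          \prod_(j < n | (j != i) && (j != k)) weight (u j).
  by apply: eq_bigr => j /andP[ji jk]; rewrite e.
by apply: ler_wpM2r le; apply: prodr_ge0 => j _; rewrite ltW ?weight_gt0.
Qed.

Lemma sum_eq2 u u' i k : i != k ->
  (forall j, j != i -> j != k -> u' j = u j) ->
  (u' i + u' k = u i + u k)%N -> (\sum_j u' j = \sum_j u j)%N.
Proof.
move=> ik e e2; rewrite !(bigD2 _ _ ik) /= !addnA e2.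
by congr (_ + _)%N; apply: eq_bigr => j /andP[ji jk]; rewrite e.
Qed.

Lemma sum_eq1 u u' i : (forall j, j != i -> u' j = u j) ->
  (\sum_j u' j + u i = \sum_j u j + u' i)%N.
Proof.
move=> e; rewrite (bigD1 i) //= [in RHS](bigD1 i) //= (eq_bigr u); first lia.
by move=> j ji; rewrite e.
Qed.

(** * Domination by optimal pairs, over an abstract down-closed family with exchange *)

Variables (P : ('I_n -> nat) -> Prop) (m : nat).
Hypothesis P_le : forall a a', (forall j, (a j <= a' j)%N) -> P a' -> P a.
Hypothesis P_exchange : forall a a' i, P a -> P a' -> (a i < a' i)%N ->
  P (fun j => a j + (j == i))%N \/
  exists k, [/\ k != i, (a' k < a k)%N & P (fun j => a j + (j == i) - (j == k))%N].

Definition utility a b : 'I_n -> nat := fun j => (c * a j + b j)%N.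

Definition feasible a b := P a /\ (\sum_j (a j + b j) <= m)%N.

Definition optimal a b := feasible a b /\
  forall a' b', feasible a' b' -> welfare (utility a' b') <= welfare (utility a b).

Lemma optimal_le a b a' b' : optimal a b -> feasible a' b' ->
  welfare (utility a b) <= welfare (utility a' b') -> optimal a' b'.
Proof.
by move=> [_ opt] f le; split=> // a'' b'' /opt h; apply: le_trans h le.
Qed.

Definition dominated a b := exists a' b',
  [/\ optimal a' b', forall j, (a j <= a' j)%N & forall j, (b j <= b' j)%N].

Variables (a b : 'I_n -> nat) (U : {set 'I_n}).
Hypothesis dom : dominated a b.
Hypothesis U_sat : forall k, k \notin U -> ~ P (fun j => a j + (j == k))%N.
Hypothesis U_b0 : forall k, k \in U -> b k = 0%N.
Hypothesis sum_lt : (\sum_j (a j + b j) < m)%N.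

Lemma lt_sat a' k : P a' -> (forall j, (a j <= a' j)%N) -> (a k < a' k)%N -> k \in U.
Proof.
move=> Pa' aa' lt; apply: contraT => /U_sat[]; apply: P_le Pa' => j.
by have [->|_] := eqVneq j k; rewrite ?addn1 ?addn0.
Qed.

(* Room for one more good in the optimal solution is made by taking away a
   good on which it exceeds (a, b). *)
Lemma exceeds a' b' :
  (forall j, (a j <= a' j)%N) -> (forall j, (b j <= b' j)%N) ->
  (\sum_j (a' j + b' j) < m)%N \/
  (exists k, (b k < b' k)%N) \/
  (forall j, b' j = b j) /\ exists k, (a k < a' k)%N.
Proof.
move=> aa' bb'; have [|le] := ltnP (\sum_j (a' j + b' j)) m; first by left.
right; have [/existsP[k lt]|/existsPn nb] := boolP [exists k, (b k < b' k)%N].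
  by left; exists k.
right; split=> [j|]; first by have := nb j; have := bb' j; lia.
have [/existsP//|/existsPn na] := boolP [exists k, (a k < a' k)%N].
suff : (\sum_j (a' j + b' j) <= \sum_j (a j + b j))%N by lia.
by apply: leq_sum => j _; have := na j; have := nb j; lia.
Qed.

(** If the dominating optimum has [a' i = a i], exchange against [a] raised at [i] adds one at [i],
    possibly at the cost of an agent [k] with [a' k > a k]. Otherwise the good is paid for by a
    value-1 good of [i], by slack, or by a surplus good of another agent. Minimality of [a i]
    prevents any loss of weight. *)
Lemma dominated_c i : i \in U -> P (fun j => a j + (j == i))%N ->
  (forall k, k \in U -> (a i <= a k)%N) ->
  (forall k, k \notin U -> (a i <= utility a b k)%N) ->
  dominated (fun j => a j + (j == i))%N b.
Proof.
move=> iU Pai minU minN; have [a' [b' [opt aa' bb']]] := dom.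
have [[Pa' sum'] _] := opt.
have [lt|le] := ltnP (a i) (a' i).
  exists a', b'; split=> // j.
  by have [->|_] := eqVneq j i; rewrite ?addn1 ?addn0.
have eai : a' i = a i by apply/eqP; rewrite eqn_leq le aa'.
have bi0 := U_b0 iU.
(* A feasible pair of no smaller welfare is itself optimal, so only domination remains to be
   arranged. *)
have improve a'' b'' : feasible a'' b'' ->
    welfare (utility a' b') <= welfare (utility a'' b'') ->
    (forall j, (a j + (j == i) <= a'' j)%N) -> (forall j, (b j <= b'' j)%N) ->
    dominated (fun j => a j + (j == i))%N b.
  by move=> f w h1 h2; exists a'', b''; split=> //; apply: optimal_le opt _ _.
(* If i holds at least c goods of value 1, exchanging c of them for the good of
   k changes no utility; here the integrality of c is used.  Otherwise all
   goods of value 1 of i go to k. *)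
have transfer_k k : k != i -> (a k < a' k)%N ->
    P (fun j => a' j + (j == i) - (j == k))%N ->
    dominated (fun j => a j + (j == i))%N b.
  move=> ki ltk Pk; have kU := lt_sat Pa' aa' ltk; have bk0 := U_b0 kU.
  have aik := minU k kU; have ik : i != k by rewrite eq_sym.
  pose t := minn c (b' i).
  apply: (improve (fun j => a' j + (j == i) - (j == k))%N
                  (fun j => b' j + t * (j == k) - t * (j == i))%N).
  - split=> //; apply: leq_trans sum'; rewrite leq_eqVlt; apply/orP; left; apply/eqP.
    apply: (sum_eq2 ik); first by move=> j /negPf -> /negPf ->; lia.
    by rewrite !eqxx (negPf ki) (negPf ik); have := geq_minr c (b' i); rewrite -/t; lia.
  - apply: (welfare_le2 ik); rewrite /utility.
      by move=> j /negPf -> /negPf ->; rewrite !muln0 !addn0 !subn0.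
    rewrite !eqxx (negPf ki) (negPf ik) eai !muln0 !muln1 !addn0 !subn0.
    case: (a' k) ltk => [//|d] ltd; rewrite addn1 subn1 /= !mulnSr.
    have leq_cad : (c * a i <= c * d)%N by rewrite leq_mul2l (leq_trans aik) ?orbT.
    have [ltc|gec] := ltnP c (b' i).
      have -> : t = c by apply/minn_idPl/ltnW.
      have -> : (c * a i + c + (b' i - c) = c * a i + b' i)%N by lia.
      by have -> : (c * d + (b' k + c) = c * d + c + b' k)%N by lia.
    have -> : t = b' i by apply/minn_idPr.
    by apply: weight_balance; lia.
  - move=> j; have [->|ji] := eqVneq j i; first by rewrite (negPf ik) eai subn0.
    by have [->|_] := eqVneq j k; have := aa' j; lia.
  move=> j; have [->|ji] := eqVneq j i; first by rewrite bi0.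
  by have := bb' j; lia.
have [|Pi|[k [ki ltk Pk]]] := @P_exchange a' _ i Pa' Pai.
- by rewrite eqxx eai addn1.
- have up j : (a j + (j == i) <= a' j + (j == i))%N by rewrite leq_add2r.
  (* A value-1 good of [i] is replaced by a good of value [c]; domination survives because
     [b i = 0]. *)
  have [bi|bi] := posnP (b' i); last first.
    apply: (improve (fun j => a' j + (j == i))%N (fun j => b' j - (j == i))%N) => //.
    + split=> //; apply: leq_trans sum'.
      apply: leq_sum => j _; have [->|_] := eqVneq j i; lia.
    + apply: (@welfare_le1 _ _ i); rewrite /utility.
        by move=> j /negPf ->; rewrite addn0 subn0.
      by rewrite eqxx; nia.
    move=> j; have [->|_] := eqVneq j i; first by rewrite bi0.
    by rewrite subn0.
  have [lts|[[k ltk]|[eb [k ltk]]]] := exceeds aa' bb'.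
  + apply: (improve (fun j => a' j + (j == i))%N b') => //.
      split=> //; suff : (\sum_j (a' j + (j == i) + b' j) <= m)%N by [].
      have e : (\sum_j (a' j + (j == i) + b' j) + (a' i + b' i) =
          \sum_j (a' j + b' j) + (a' i + (i == i) + b' i))%N.
        apply: (@sum_eq1 (fun j => a' j + b' j)%N (fun j => a' j + (j == i) + b' j)%N).
        by move=> j /negPf ->; rewrite addn0.
      by move: lts e; rewrite eqxx; lia.
    apply: (@welfare_le1 _ _ i); rewrite /utility.
      by move=> j /negPf ->; rewrite addn0.
    by rewrite eqxx; nia.
  + have ik : i != k by apply: contraTneq ltk => <-; rewrite bi.
    have ki : k != i by rewrite eq_sym.
    apply: (improve (fun j => a' j + (j == i))%N (fun j => b' j - (j == k))%N) => //.
    * split=> //; apply: leq_trans sum'; rewrite leq_eqVlt; apply/orP; left; apply/eqP.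
      apply: (sum_eq2 ik); first by move=> j /negPf -> /negPf ->; lia.
      by rewrite !eqxx (negPf ki) (negPf ik); lia.
    * apply: (welfare_le2 ik); rewrite /utility.
        by move=> j /negPf -> /negPf ->; rewrite !addn0 !subn0.
      rewrite !eqxx (negPf ki) (negPf ik) eai bi !addn0 ?subn0.
      have -> : (c * a' k + b' k = (c * a' k + (b' k - 1)).+1)%N by lia.
      rewrite mulnDr muln1; apply: weight_c_one.
      (* The bound [a i <= c * a' k + (b' k - 1)] follows in [U] from [a i <= a k] and [b' k > 0],
         and outside [U] from [a i <= utility a b k] and [b k < b' k]. *)
      have := aa' k; have [/minU|/minN] := boolP (k \in U); rewrite /utility; nia.
    move=> j; have [->|_] := eqVneq j k; last by rewrite subn0.
    by lia.
  apply: (transfer_k k) => //.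
    by apply: contraTneq ltk => ->; rewrite eai ltnn.
  by apply: P_le Pi => j; apply: leq_subr.
apply: (transfer_k k) => //; move: ltk; by rewrite (negPf ki) addn0.
Qed.

(** Saturation forces [a' i = a i]. If also [b' i = b i], agent [i] receives a value-1 good out of
    slack, from the value-1 surplus of some [k], or in place of a value-[c] good of some [k] in
    [U]. *)
Lemma dominated_one i : i \notin U ->
  (forall k, k \in U -> (utility a b i < a k)%N) ->
  (forall k, k \notin U -> (utility a b i <= utility a b k)%N) ->
  dominated a (fun j => b j + (j == i))%N.
Proof.
move=> iU minU minN; have [a' [b' [opt aa' bb']]] := dom.
have [[Pa' sum'] _] := opt.
have eai : a' i = a i.
  apply/eqP; rewrite eqn_leq aa' andbT leqNgt.
  by apply: contra iU; apply: lt_sat.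
have [lt|le] := ltnP (b i) (b' i).
  exists a', b'; split=> // j.
  by have [->|_] := eqVneq j i; rewrite ?addn1 ?addn0.
have ebi : b' i = b i by apply/eqP; rewrite eqn_leq le bb'.
have improve a'' b'' : feasible a'' b'' ->
    welfare (utility a' b') <= welfare (utility a'' b'') ->
    (forall j, (a j <= a'' j)%N) -> (forall j, (b j + (j == i) <= b'' j)%N) ->
    dominated a (fun j => b j + (j == i))%N.
  by move=> f w h1 h2; exists a'', b''; split=> //; apply: optimal_le opt _ _.
have up j : (b j + (j == i) <= b' j + (j == i))%N by rewrite leq_add2r.
have [lts|[[k ltk]|[eb [k ltk]]]] := exceeds aa' bb'.
- apply: (improve a' (fun j => b' j + (j == i))%N) => //.
    split=> //; suff : (\sum_j (a' j + (b' j + (j == i))) <= m)%N by [].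
    have e : (\sum_j (a' j + (b' j + (j == i))) + (a' i + b' i) =
        \sum_j (a' j + b' j) + (a' i + (b' i + (i == i))))%N.
      apply: (@sum_eq1 (fun j => a' j + b' j)%N (fun j => a' j + (b' j + (j == i)))%N).
      by move=> j /negPf ->; rewrite addn0.
    by move: lts e; rewrite eqxx; lia.
  apply: (@welfare_le1 _ _ i); rewrite /utility.
    by move=> j /negPf ->; rewrite addn0.
  by rewrite eqxx; lia.
- have ik : i != k by apply: contraTneq ltk => <-; rewrite ebi ltnn.
  have ki : k != i by rewrite eq_sym.
  apply: (improve a' (fun j => b' j + (j == i) - (j == k))%N) => //.
  + split=> //; apply: leq_trans sum'; rewrite leq_eqVlt; apply/orP; left; apply/eqP.
    apply: (sum_eq2 ik); first by move=> j /negPf -> /negPf ->; lia.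
    by rewrite !eqxx (negPf ki) (negPf ik); lia.
  + apply: (welfare_le2 ik); rewrite /utility.
      by move=> j /negPf -> /negPf ->; rewrite !addn0 !subn0.
    rewrite !eqxx (negPf ki) (negPf ik) eai ebi !addn0 !subn0.
    have := aa' k; have [/minU|/minN] := boolP (k \in U); rewrite /utility => *.
      by apply: weight_balance; nia.
    by apply: weight_balance; nia.
  move=> j; have [->|_] := eqVneq j k; last by rewrite subn0 up.
  by rewrite (negPf ki); lia.
have ik : i != k by apply: contraTneq ltk => <-; rewrite eai ltnn.
have ki : k != i by rewrite eq_sym.
have kU := lt_sat Pa' aa' ltk.
apply: (improve (fun j => a' j - (j == k))%N (fun j => b' j + (j == i))%N) => //.
+ split; first by apply: P_le Pa' => j; apply: leq_subr.
  apply: leq_trans sum'; rewrite leq_eqVlt; apply/orP; left; apply/eqP.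
  apply: (sum_eq2 ik); first by move=> j /negPf -> /negPf ->; lia.
  by rewrite !eqxx (negPf ki) (negPf ik); lia.
+ apply: (welfare_le2 ik); rewrite /utility.
    by move=> j /negPf -> /negPf ->; rewrite !addn0 !subn0.
  rewrite !eqxx (negPf ki) (negPf ik) eai ebi !addn0 !subn0 eb (U_b0 kU) !addn0.
  (* The remaining [a' k - 1] goods of [k] still number at least [a k], which exceeds the utility of
     [i] as [weight_one_c] requires. *)
  have {1}-> : a' k = (a' k - 1 + 1)%N by lia.
  rewrite mulnDr muln1 addn1 addnS; apply: weight_one_c.
  by have := minU k kU; rewrite /utility; lia.
move=> j; have [->|_] := eqVneq j k; last by rewrite subn0.
by lia.
Qed.

End Welfare.

(** * Clean vectors and optimal pairs for the given valuations *)

Section Algorithm.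

Variables (R : realType) (n : nat) (G : finType) (c : nat).
Variables (v : 'I_n -> {set G} -> R) (M : R).
Hypotheses (n_gt0 : (0 < n)%N) (c_ge2 : (2 <= c)%N).
Hypothesis v_SUB : forall i, one_c_SUB c%:R (v i).
Hypothesis M_gt2 : 2 < M.

Local Notation r := (beta c%:R v).
Local Notation P := (clean_vector c%:R v).
Implicit Types (X Y : allocation n G) (s : state n G) (i j k : 'I_n).

Let rN : forall S, r None S = #|S| := beta_None c v.

Definition cnt X j : nat := #|bundle X (Some j)|.

Lemma rankP (j : option 'I_n) : matroid_rank (r j).
Proof.
case: j => [i|]; first by have [] := beta_matroid c_ge2 (v_SUB i).
split=> [|S g|S T g ST]; rewrite !beta_None ?cards0 // !cardsU1.
  by case: (g \in S); rewrite /= ?add0n ?add1n ?leqnn ?leqnSn.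
by have := subsetP ST g; case: (g \in S) => [->//|_]; case: (g \in T); lia.
Qed.

Lemma val_rank i S : v i S = (#|S| + c.-1 * r (Some i) S)%:R.
Proof. by have [] := beta_matroid c_ge2 (v_SUB i). Qed.

Lemma P_le a a' : (forall j, (a j <= a' j)%N) -> P a' -> P a.
Proof. exact: (clean_vector_le rankP rN). Qed.

Lemma P_exchange a a' i : P a -> P a' -> (a i < a' i)%N ->
  P (fun j => a j + (j == i))%N \/
  exists k, [/\ k != i, (a' k < a k)%N & P (fun j => a j + (j == i) - (j == k))%N].
Proof.
move=> [X cX Xa] [Z cZ Za]; rewrite -Xa -Za => lt.
have [h|[k [ki ltk h]]] := clean_vector_exchange rankP rN cX cZ lt.
  by left; apply: clean_vector_ext h => j; rewrite Xa.
right; exists k; rewrite -Xa -Za; split=> //.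
by apply: clean_vector_ext h => j; rewrite Xa.
Qed.

Definition val_nat Y j : nat :=
  (#|bundle Y (Some j)| + c.-1 * r (Some j) (bundle Y (Some j)))%N.

Lemma val_natE Y j : v j (bundle Y (Some j)) = (val_nat Y j)%:R.
Proof. exact: val_rank. Qed.

Lemma eq_welfare u u' : u =1 u' -> welfare M u = welfare (n := n) M u'.
Proof. by move=> e; apply: eq_bigr => j _; rewrite e. Qed.

(** A basis of each bundle supplies the goods of value [c]; the rest of the bundle counts as value
    1. Thus optimality over feasible pairs covers all allocations, clean or not. *)
Lemma feasible_val Y : exists a b, feasible P #|G| a b /\ utility c a b =1 val_nat Y.
Proof.
have /fin_all_exists2[T TY Tr] j : exists2 T : {set G}, T \subset bundle Y (Some j) &
    indep (r (Some j)) T /\ #|T| = r (Some j) (bundle Y (Some j)).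
  exact: (basis_ex (rankP _)).
have [Z cZ ZT] := clean_bundle rN TY (fun j => (Tr j).1).
exists (fun j => #|T j|), (fun j => #|bundle Y (Some j)| - #|T j|)%N.
have le j : (#|T j| <= #|bundle Y (Some j)|)%N by apply: subset_leq_card.
split=> [|j]; last first.
  rewrite /utility /val_nat -(Tr j).2; have := le j.
  rewrite -{1}(prednK (ltnW c_ge2)) mulSn; lia.
split; first by exists Z => // j; rewrite ZT.
rewrite (eq_bigr (fun j => #|bundle Y (Some j)|)) => [|j _]; last by rewrite subnKC.
by rewrite -(sum_card_bundle Y) leq_addr.
Qed.

Lemma clean_init : clean c%:R v [ffun=> None].
Proof.
apply: (clean_Some rN) => j.
have -> : bundle [ffun=> None] (Some j) = set0 :> {set G}.
  by apply/setP => g; rewrite !inE ffunE.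
by rewrite /indep (rank0 (rankP _)) cards0.
Qed.

Lemma cnt_init j : cnt [ffun=> None] j = 0%N.
Proof. by apply: eq_card0 => g; rewrite !inE ffunE. Qed.

Lemma optimal_ex : exists a b, optimal M c P #|G| a b.
Proof.
(* Each [b j] is at most [|G|], so feasible pairs can be searched in a finite type. *)
pose T := (allocation n G * {ffun 'I_n -> 'I_#|G|.+1})%type.
pose Q (z : T) := clean c%:R v z.1 &&
  (\sum_j (cnt z.1 j + z.2 j) <= #|G|)%N.
pose u (z : T) := utility c (cnt z.1) (fun j => z.2 j : nat).
pose z0 : T := ([ffun=> None], [ffun=> ord0]).
have Qz0 : Q z0.
  by rewrite /Q clean_init big1 // => j _; rewrite cnt_init ffunE.
case: (@arg_maxP _ _ _ z0 Q (fun z => welfare M (u z)) Qz0) => z /andP[cz sz] zmax.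
exists (cnt z.1), (fun j => z.2 j : nat).
split; first by split=> //; exists z.1.
move=> a b [[X cX Xa] sumab].
pose z' : T := (X, [ffun j => inord (b j)]).
have bj j : (inord (b j) : 'I_#|G|.+1) = b j :> nat.
  rewrite inordK // ltnS; apply: leq_trans sumab.
  by rewrite (bigD1 j) //=; lia.
have e : utility c a b =1 u z'.
  by move=> j; rewrite /u /utility /z' /= ffunE bj /cnt Xa.
rewrite (eq_welfare e); apply: zmax.
rewrite /Q cX; apply: leq_trans sumab; rewrite leq_eqVlt; apply/orP; left.
by apply/eqP/eq_bigr => j _; rewrite /z' /= ffunE bj /cnt Xa.
Qed.

(** * The loop invariant and the order of the gains *)

Record invariant s : Prop := Invariant {
  inv_clean : clean c%:R v (st_c s);
  inv_one : forall g j, st_one s g = Some j -> st_c s g = None;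
  inv_U : forall k, k \in st_U s -> cnt (st_one s) k = 0%N;
  inv_sat : forall k, k \notin st_U s -> ~ P (fun j => cnt (st_c s) j + (j == k))%N;
  inv_dom : dominated M c P #|G| (cnt (st_c s)) (cnt (st_one s)) }.

Definition util s : 'I_n -> nat := utility c (cnt (st_c s)) (cnt (st_one s)).

Lemma invariant_init : invariant (init_state n G).
Proof.
split=> /=.
- exact: clean_init.
- by move=> g j; rewrite ffunE.
- by move=> k _; rewrite cnt_init.
- by move=> k; rewrite inE.
have [a [b opt]] := optimal_ex; exists a, b; split=> // j; by rewrite cnt_init.
Qed.

Lemma bundle_output s j : invariant s ->
  bundle (output s) (Some j) = bundle (st_c s) (Some j) :|: bundle (st_one s) (Some j).
Proof.
move=> inv; apply/setP => g; rewrite !inE ffunE.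
case Xg: (st_c s g) => [k|] //=; apply/idP/idP => [->//|/orP[//|/eqP /(inv_one inv)]].
by rewrite Xg.
Qed.

(** Value-1 goods go only to saturated agents: if one of them raised the rank of the clean bundle,
    moving it there would contradict [inv_sat]. Agents in [U] hold none. *)
Lemma val_nat_output s : invariant s -> val_nat (output s) =1 util s.
Proof.
move=> inv j; rewrite /val_nat bundle_output //.
set A := bundle _ _; set B := bundle _ _.
have BA0 : A :&: B = set0.
  apply/setP => g; rewrite !inE; apply/negP => /andP[/eqP e /eqP /(inv_one inv)].
  by rewrite e.
have rA : r (Some j) A = #|A| by apply/eqP/(forallP (inv_clean inv)).
have -> : r (Some j) (A :|: B) = #|A|.
  have [jU|jU] := boolP (j \in st_U s).
    by have -> : B = set0 := cards0_eq (inv_U inv jU); rewrite setU0.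
  rewrite setUC -rA; apply: (rank_span_set (rankP _)) => g.
  rewrite mem_bundle => /eqP /(inv_one inv) Xg.
  have gA : g \notin A by rewrite mem_bundle Xg.
  apply/eqP/negPn/negP => ne; apply: (inv_sat inv jU).
  have XD k : bundle (st_c s) (Some k) :\ g = bundle (st_c s) (Some k).
    by rewrite setD1_notin // mem_bundle Xg.
  exists (move (st_c s) g (Some j)) => [|k]; last first.
    rewrite bundle_move (inj_eq Some_inj) XD /cnt.
    by have [->|_] := eqVneq k j; rewrite ?addn0 // cardsU1 gA addnC.
  apply: (clean_Some rN) => k; rewrite bundle_move (inj_eq Some_inj) XD.
  have [->|_] := eqVneq k j; last exact: (forallP (inv_clean inv)).
  by rewrite (rank_setU1_indep (rankP _)) // (forallP (inv_clean inv)).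
rewrite cardsU BA0 cards0 subn0 /util /utility -[c in RHS](prednK (ltnW c_ge2)) mulSn.
by rewrite /cnt -/A -/B; lia.
Qed.

Definition gain (u d : nat) : R := if u == 0%N then M * d%:R else (u + d)%:R / u%:R.

Lemma nash_gain_output s k (d : nat) : invariant s ->
  nash_gain v M (output s) k d%:R = gain (util s k) d.
Proof.
move=> inv; rewrite /nash_gain val_natE val_nat_output // ltr0n /gain lt0n.
by case: eqP => //= _; rewrite natrD.
Qed.

Lemma gain0 d : gain 0 d = M * d%:R. Proof. by []. Qed.

Lemma gain_le_pos u u' d d' : (0 < u)%N -> (0 < u')%N ->
  (gain u d <= gain u' d') = ((u + d) * u' <= (u' + d') * u)%N.
Proof.
rewrite /gain; case: u => // u; case: u' => // u' _ _ /=.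
by rewrite ler_pdivrMr ?ltr0n // mulrAC ler_pdivlMr ?ltr0n // -!natrM ler_nat.
Qed.

(** A positive utility [u >= d] gives a gain of at most 2, below [M]. *)
Lemma gain_lt0 u d d' : (0 < u)%N -> (d <= u)%N -> (0 < d')%N ->
  gain u d < gain 0 d'.
Proof.
move=> u0 du d0; rewrite gain0 /gain; case: u u0 du => // u _ du /=.
rewrite ltr_pdivrMr ?ltr0n //; apply: (@le_lt_trans _ _ (2 * u.+1%:R)).
  by rewrite -natrM ler_nat; lia.
rewrite ltr_pM2r ?ltr0n //; apply: (lt_le_trans M_gt2).
by rewrite ler_peMr ?ler1n //; have := M_gt2; lra.
Qed.

Lemma gain_c_le a a' : (gain (c * a') c <= gain (c * a) c) = (a <= a')%N.
Proof.
case: a a' => [|a] [|a']; rewrite ?muln0 ?lexx //.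
- by rewrite ltW // gain_lt0 // ?muln_gt0 ?leq_pmulr // ltnW.
- by apply/negbTE; rewrite -ltNge gain_lt0 // ?muln_gt0 ?leq_pmulr // ltnW.
rewrite gain_le_pos ?muln_gt0 ?(ltnW c_ge2) // -!mulnSr !mulnA.
rewrite ![(_ * c * _)%N]mulnAC -!mulnA !leq_pmul2l ?(ltnW c_ge2) //; nia.
Qed.

(** For positive arguments [c] cancels and [(u + 1)/u] is compared with [(a + 1)/a]. When both are
    zero, [M <= M c] favours the [c]-step. *)
Lemma gain_one_le_c u a : (gain u 1 <= gain (c * a) c) = (a <= u)%N.
Proof.
have c0 := ltnW c_ge2.
case: a u => [|a] [|u]; rewrite ?muln0.
- by rewrite !gain0 ler_pM2l ?ler_nat //; have := M_gt2; lra.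
- by rewrite ltW // gain_lt0.
- by apply/negbTE; rewrite -ltNge gain_lt0 ?muln_gt0 ?leq_pmulr ?c0.
rewrite gain_le_pos ?muln_gt0 ?c0 // -mulnSr.
have -> : ((u.+1 + 1) * (c * a.+1) = c * ((u.+1 + 1) * a.+1))%N by lia.
by rewrite -mulnA leq_pmul2l //; nia.
Qed.

Lemma gain_one_le u u' : (gain u' 1 <= gain u 1) = (u <= u')%N.
Proof.
case: u u' => [|u] [|u']; rewrite ?lexx //.
- by rewrite ltW // gain_lt0.
- by apply/negbTE; rewrite -ltNge gain_lt0.
by rewrite gain_le_pos //; nia.
Qed.

Lemma util_U s k : invariant s -> k \in st_U s -> util s k = (c * cnt (st_c s) k)%N.
Proof. by move=> inv kU; rewrite /util /utility (inv_U inv kU) addn0. Qed.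

(** Translates the selection rule into the minimality hypotheses of [dominated_c]. *)
Lemma picked_c_min s i : invariant s ->
  (Gain_1 (nash_gain v M) s <= Gain_c c%:R (nash_gain v M) s)%E ->
  picked_c c%:R (nash_gain v M) s i ->
  (forall k, k \in st_U s -> (cnt (st_c s) i <= cnt (st_c s) k)%N) /\
  (forall k, k \notin st_U s -> (cnt (st_c s) i <= util s k)%N).
Proof.
move=> inv le1c [iU ei _]; split=> k kU.
  have : ((nash_gain v M (output s) k c%:R)%:E <= Gain_c c%:R (nash_gain v M) s)%E.
    exact: (le_bigmax_cond _ (fun k => (nash_gain v M (output s) k c%:R)%:E) kU).
  by rewrite -ei lee_fin !nash_gain_output // !util_U // gain_c_le.
have : ((nash_gain v M (output s) k 1)%:E <= Gain_1 (nash_gain v M) s)%E.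
  by apply: (le_bigmax_cond _ (fun k => (nash_gain v M (output s) k 1)%:E)); rewrite inE.
move=> /le_trans /(_ le1c); rewrite -ei lee_fin -[1]/(1%:R) !nash_gain_output //.
by rewrite (util_U inv iU) gain_one_le_c.
Qed.

Lemma picked_1_min s i : invariant s ->
  (Gain_c c%:R (nash_gain v M) s < Gain_1 (nash_gain v M) s)%E ->
  picked_1 (nash_gain v M) s i ->
  (forall k, k \in st_U s -> (util s i < cnt (st_c s) k)%N) /\
  (forall k, k \notin st_U s -> (util s i <= util s k)%N).
Proof.
move=> inv ltc1 [iU ei _]; split=> k kU.
  have : ((nash_gain v M (output s) k c%:R)%:E <= Gain_c c%:R (nash_gain v M) s)%E.
    exact: (le_bigmax_cond _ (fun k => (nash_gain v M (output s) k c%:R)%:E) kU).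
  move=> /le_lt_trans /(_ ltc1); rewrite -ei lte_fin -[1]/(1%:R) !nash_gain_output //.
  by rewrite (util_U inv kU) ltNge gain_one_le_c -ltnNge.
have : ((nash_gain v M (output s) k 1)%:E <= Gain_1 (nash_gain v M) s)%E.
  by apply: (le_bigmax_cond _ (fun k => (nash_gain v M (output s) k 1)%:E)); rewrite inE.
by rewrite -ei lee_fin -[1]/(1%:R) !nash_gain_output // gain_one_le.
Qed.

Lemma dominated_ext a a' b b' : a =1 a' -> b =1 b' ->
  dominated M c P #|G| a b -> dominated M c P #|G| a' b'.
Proof.
move=> ea eb [x [y [opt ax bY]]]; exists x, y.
by split=> // j; rewrite -?ea -?eb.
Qed.

Lemma runningE s : running s = (\sum_j (cnt (st_c s) j + cnt (st_one s) j) < #|G|)%N.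
Proof. by rewrite /running big_split -(sum_card_bundle (st_c s)) ltn_add2l. Qed.

Lemma in_free_goods s g :
  (g \in free_goods s) = (st_c s g == None) && (st_one s g == None).
Proof.
rewrite !inE andbC; congr (_ && _); apply/idP/idP.
  case e: (st_one s g) => [j|//] /bigcupP[]; exists j => //.
  by rewrite mem_bundle e.
by move=> /eqP e; apply/bigcupP => -[j _]; rewrite mem_bundle e.
Qed.

Lemma free_goods_ex s : running s -> exists h, h \in free_goods s.
Proof.
move=> run; apply/set0Pn/negP => /eqP f0; move: run; rewrite /running ltnNge.
have := sum_card_bundle (st_one s); have := cardsC (bundle (st_one s) None).
have : (#|bundle (st_c s) None| <= #|~: bundle (st_one s) None|)%N.
  apply: subset_leq_card; apply/subsetP => g; rewrite !inE => /eqP e.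
  by have := in_set0 g; rewrite -f0 in_free_goods e /= => ->.
lia.
Qed.

Lemma cnt_give (one : allocation n G) h i j : one h = None ->
  cnt [ffun x => if x == h then Some i else one x] j = (cnt one j + (j == i))%N.
Proof.
move=> oh; have hS : h \notin bundle one (Some j) by rewrite mem_bundle oh.
have -> : [ffun x => if x == h then Some i else one x] = move one h (Some i).
  by apply/ffunP => x; rewrite !ffunE.
rewrite /cnt bundle_move (inj_eq Some_inj); have [_|_] := eqVneq j i.
  by rewrite cardsU1 hS addnC.
by rewrite addn0 setD1_notin.
Qed.

Lemma cnt_replace (one : allocation n G) h l j : one l = Some j -> one h = None ->
  cnt [ffun x => if x == l then None else if x == h then Some j else one x]
  =1 cnt one.
Proof.
move=> ol oh k; have hl : h != l by apply: contraPneq oh => ->; rewrite ol.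
have -> : [ffun x => if x == l then None else if x == h then Some j else one x] =
    move (move one h (Some j)) l None by apply/ffunP => x; rewrite !ffunE.
rewrite /cnt !bundle_move (inj_eq Some_inj) /=.
have hS : h \notin bundle one (Some k) by rewrite mem_bundle oh.
have [->|kj] := eqVneq k j.
  have lh : l \notin [set h] by rewrite inE eq_sym.
  by rewrite setDUl (setD1_notin lh) cardsU1D1 ?mem_bundle ?ol ?oh.
have lS : l \notin bundle one (Some k).
  by rewrite mem_bundle ol (inj_eq Some_inj) eq_sym.
by rewrite !setD1_notin.
Qed.

(** Only the counts of [one] matter, so this serves transfers both with and without replacement.
    Saturation persists since clean bundles never shrink in size and [P] is down-closed. *)
Lemma transfer_invariant s i p (one : allocation n G) :
  invariant s -> running s -> picked_c c%:R (nash_gain v M) s i ->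
  (Gain_1 (nash_gain v M) s <= Gain_c c%:R (nash_gain v M) s)%E ->
  shortest_transfer_path c%:R v (st_c s) i p ->
  (forall g j, one g = Some j -> transfer (st_c s) i p g = None) ->
  cnt one =1 cnt (st_one s) ->
  invariant (State (transfer (st_c s) i p) one (st_U s)).
Proof.
move=> inv run pick le sp oneN ecnt.
have [minU minN] := picked_c_min inv le pick; have [iU _ _] := pick.
have [ct cntt _] := shortest_transfer_clean rankP rN (inv_clean inv) sp.
have Pi : P (fun j => cnt (st_c s) j + (j == i))%N by exists (transfer (st_c s) i p).
split=> //=.
- by move=> k kU; rewrite ecnt (inv_U inv).
- move=> k kU Pk; apply: (inv_sat inv kU); apply: P_le Pk => j.
  by rewrite /cnt cntt leq_add2r leq_addr.
apply: (@dominated_ext (fun j => cnt (st_c s) j + (j == i))%N _ (cnt (st_one s))).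
- by move=> j; rewrite /cnt cntt.
- by move=> j; rewrite ecnt.
apply: (dominated_c M_gt2 c_ge2 P_le P_exchange (inv_dom inv) (inv_sat inv)
          (inv_U inv)) => //.
by rewrite -runningE.
Qed.

Lemma step_invariant s s' : invariant s -> running s ->
  step c%:R v (nash_gain v M) s s' -> invariant s'.
Proof.
move=> inv run; case.
- move=> i g q le pick sp e.
  have [_ _ /(_ g q erefl)[Xl Bl]] :=
    shortest_transfer_clean rankP rN (inv_clean inv) sp.
  apply: transfer_invariant => // x j xj.
  apply/eqP; rewrite -mem_bundle Bl !inE (inv_one inv xj) eqxx andbT.
  by apply: contraPneq xj => ->; rewrite e.
- move=> i g q j h le pick sp e hf.
  have [_ _ /(_ g q erefl)[Xl Bl]] :=
    shortest_transfer_clean rankP rN (inv_clean inv) sp.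
  move: hf; rewrite in_free_goods => /andP[/eqP ch /eqP oh].
  apply: transfer_invariant => // [x k xk|]; last exact: cnt_replace.
  apply/eqP; rewrite -mem_bundle Bl !inE; move: xk.
  rewrite !ffunE; case: eqP => //= _; case: eqP => [-> _|_ /(inv_one inv) ->] //.
  by rewrite ch.
- move=> i le pick nop; split=> /=; try by case: inv.
  + by move=> k; rewrite !inE => /andP[_]; apply: inv_U.
  (* The agent just removed has no transfer path and is therefore saturated. *)
  move=> k; rewrite !inE negb_and negbK => /orP[/eqP ->|]; last exact: inv_sat.
  by apply: (no_transfer_path_vector rankP) nop; apply: inv_clean.
move=> i h lt pick; rewrite in_free_goods => /andP[/eqP ch /eqP oh].
have [minU minN] := picked_1_min inv lt pick; have [iU _ _] := pick.
have iU' : i \notin st_U s by move: iU; rewrite inE.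
split=> /=; try by case: inv.
- move=> g j; rewrite ffunE; case: eqP => [->//|_]; exact: (inv_one inv).
- move=> k kU; rewrite cnt_give // (inv_U inv kU).
  by apply/eqP; rewrite eqb0; apply: contraNneq iU' => <-.
apply: (@dominated_ext (cnt (st_c s)) _ (fun j => cnt (st_one s) j + (j == i))%N) => //.
  by move=> j; rewrite cnt_give.
apply: (dominated_one M_gt2 c_ge2 P_le (inv_dom inv) (inv_sat inv)
          (inv_U inv)) => //.
by rewrite -runningE.
Qed.

(** * Progress, termination and optimality of the output *)

Lemma bigmaxe_first (A : {set 'I_n}) (f : 'I_n -> R) : A != set0 ->
  exists i, [/\ i \in A, (f i)%:E = \big[maxe/-oo%E]_(k in A) (f k)%:E &
    forall k, k \in A -> (f k)%:E = \big[maxe/-oo%E]_(k in A) (f k)%:E -> (i <= k)%N].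
Proof.
move=> /set0Pn[i0 i0A].
have [i1 i1A e1] := eq_bigmax (x := -oo%E) i0 (mem A) (fun k => (f k)%:E) i0A (fun k _ => leNye _).
pose Q := [pred k | (k \in A) && ((f k)%:E == \big[maxe/-oo%E]_(k in A) (f k)%:E)].
have Q1 : Q i1 by rewrite /= e1 eqxx andbT.
case: (@arg_minnP _ i1 Q (fun k => k : nat) Q1) => i /andP[iA /eqP ei] imin.
by exists i; split=> // k kA ek; apply: imin; rewrite /= kA ek eqxx.
Qed.

Lemma step_ex s : running s -> exists s', step c%:R v (nash_gain v M) s s'.
Proof.
move=> run; have [h hf] := free_goods_ex run.
have [le|lt] := leP (Gain_1 (nash_gain v M) s) (Gain_c c%:R (nash_gain v M) s).
  (* With [U] empty, [Gain_c] would be [-oo], while [Gain_1] exceeds it because some agent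
     exists. *)
  have U0 : st_U s != set0.
    apply: contraTneq le => U0; rewrite -ltNge /Gain_c U0 big_set0.
    apply: lt_le_trans (ltNyr _) (le_bigmax_cond _ _ (_ : Ordinal n_gt0 \in _)).
    by rewrite U0 !inE.
  have [i pick] := bigmaxe_first (fun k => nash_gain v M (output s) k c%:R) U0.
  have [/exists_inP[g gF /exists_inP[g' g'N /connectP[p pp lp]]]|nop] := boolP
    [exists g in F_set c%:R v (st_c s) i, exists g' in bundle (st_c s) None,
       connect (exchange_edge c%:R v (st_c s)) g g'].
    have tp : transfer_path c%:R v (st_c s) i (g :: p) by rewrite /= gF pp -lp.
    have [[|x q] sp] := shortest_transfer_ex tp; first by case: sp.
    case e: (st_one s (last x q)) => [j|]; eexists.
      exact: StepTransferReplace le pick sp e hf.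
    exact: StepTransfer le pick sp e.
  eexists; apply: StepRemove le pick _ => -[//|g q].
  apply: contra nop => /and3P[gF pq lq]; apply/exists_inP; exists g => //.
  by apply/exists_inP; exists (last g q) => //; apply/connectP; exists q.
have U0 : ~: st_U s != set0.
  by apply: contraTneq lt => U0; rewrite -leNgt /Gain_1 U0 big_set0 leNye.
have [i pick] := bigmaxe_first (fun k => nash_gain v M (output s) k 1) U0.
by eexists; apply: StepOne lt pick hf.
Qed.

(** Each iteration either removes an agent from [U] or allocates one more good. *)
Definition measure s : nat :=
  #|st_U s| + (#|G| - \sum_j (cnt (st_c s) j + cnt (st_one s) j)).

Lemma sum_succ (f g : 'I_n -> nat) i : (forall j, g j = f j + (j == i))%N ->
  (\sum_j g j = (\sum_j f j).+1)%N.
Proof.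
move=> e; rewrite (eq_bigr (fun j => f j + (j == i))%N) // big_split /= -addn1.
by congr (_ + _)%N; rewrite (bigD1 i) //= eqxx big1 // => j /negPf ->.
Qed.

Lemma step_measure s s' : invariant s -> running s ->
  step c%:R v (nash_gain v M) s s' -> (measure s' < measure s)%N.
Proof.
move=> inv; rewrite runningE => lt st.
suff : (#|st_U s'| < #|st_U s|)%N /\
    (\sum_j (cnt (st_c s') j + cnt (st_one s') j) =
     \sum_j (cnt (st_c s) j + cnt (st_one s) j))%N \/
  st_U s' = st_U s /\ exists i, forall j,
    (cnt (st_c s') j + cnt (st_one s') j = cnt (st_c s) j + cnt (st_one s) j + (j == i))%N.
  rewrite /measure => -[[lU ->]|[-> [i /sum_succ ->]]]; lia.
case: st => [i g q _ _ sp _|i g q j h _ _ sp e|i _ [iU _ _] _|i h _ _].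
- have [_ h2 _] := shortest_transfer_clean rankP rN (inv_clean inv) sp.
  by right; split=> //; exists i => j; rewrite /= /cnt h2 addnAC.
- rewrite in_free_goods => /andP[_ /eqP oh]; right; split=> //; exists i => k /=.
  have [_ h2 _] := shortest_transfer_clean rankP rN (inv_clean inv) sp.
  by rewrite cnt_replace // /cnt h2 addnAC.
- by left; rewrite /= [X in (_ < X)%N](cardsD1 i) iU.
rewrite in_free_goods => /andP[_ /eqP oh]; right; split=> //; exists i => k /=.
by rewrite cnt_give // addnA.
Qed.

Lemma all_runs_optimal (Q : allocation n G -> Prop) :
  (forall X, (forall Y, welfare M (val_nat Y) <= welfare M (val_nat X)) -> Q X) ->
  yankee_swap_computes c%:R v (nash_gain v M) Q.
Proof.
move=> QP; suff main (m : nat) s : (measure s < m)%N -> invariant s ->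
    all_runs c%:R v (nash_gain v M) Q s.
  exact: (main _ _ (ltnSn _) invariant_init).
elim: m s => // m IH s; rewrite ltnS => lem inv.
have [run|halt] := boolP (running s).
  apply: RunsStep => //; first exact: step_ex.
  move=> s' st; apply: IH; last exact: (step_invariant inv run st).
  exact: leq_trans (step_measure inv run st) lem.
apply: RunsHalt => //; apply: QP => Y.
have [a [b [[[_ sumab] opt] ca cb]]] := inv_dom inv.
(* The dominating optimum uses at most [|G|] goods and the current pair already uses that many, so
   they agree at every agent. *)
have eab j : a j = cnt (st_c s) j /\ b j = cnt (st_one s) j.
  move: halt; rewrite runningE -leqNgt => /(leq_trans sumab).
  rewrite (bigD1 j) //= [leqRHS](bigD1 j) //=.
  have : (\sum_(i < n | i != j) (cnt (st_c s) i + cnt (st_one s) i) <=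
          \sum_(i < n | i != j) (a i + b i))%N.
    by apply: leq_sum => i _; apply: leq_add.
  move=> h3 h4; have h : (a j + b j <= cnt (st_c s) j + cnt (st_one s) j)%N.
    by move: (leq_trans h4 (leq_add (leqnn _) h3)); rewrite leq_add2r.
  by have := ca j; have := cb j; split; lia.
have [a' [b' [f e]]] := feasible_val Y.
rewrite -(eq_welfare e); have := opt a' b' f.
suff -> : welfare M (utility c a b) = welfare M (val_nat (output s)) by [].
apply: eq_welfare => j; rewrite val_nat_output // /util /utility.
by have [-> ->] := eab j.
Qed.

(** * From weighted welfare to max Nash welfare *)

Lemma welfareE u : welfare (n := n) M u =
  M^-1 ^+ (n - #|[set k | 0 < u k]%N|) * \prod_(k | (0 < u k)%N) (u k)%:R.
Proof.
rewrite /welfare (bigID (fun k => 0 < u k)%N) /= mulrC; congr (_ * _).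
  rewrite (eq_bigr (fun=> M^-1)) => [|k]; last by rewrite lt0n negbK => /eqP ->.
  rewrite prodr_const; congr (_ ^+ _).
  set A := [set k | _]; have e := cardsC A; rewrite card_ord in e.
  have -> : (n - #|A|)%N = #|~: A| by rewrite -[X in (X - _)%N]e addKn.
  by apply: eq_card => k; rewrite !inE.
by apply: eq_bigr => k u0; rewrite weight_pos.
Qed.

Lemma positive_agentsE Y : positive_agents v Y = [set k | 0 < val_nat Y k]%N.
Proof. by apply/setP => k; rewrite !inE val_natE ltr0n. Qed.

Lemma nash_productE Y : nash_product v Y = \prod_(k | (0 < val_nat Y k)%N) (val_nat Y k)%:R.
Proof.
rewrite /nash_product positive_agentsE; apply: eq_big => k; first by rewrite inE.
by rewrite val_natE.
Qed.

Lemma welfare_nashE Y : welfare M (val_nat Y) =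
  M^-1 ^+ (n - #|positive_agents v Y|) * nash_product v Y.
Proof. by rewrite welfareE positive_agentsE nash_productE. Qed.

Lemma nash_product_ge1 Y : 1 <= nash_product v Y.
Proof.
rewrite nash_productE; apply: (big_ind (fun x : R => 1 <= x)) => //.
  by move=> x y; apply: mulr_ege1.
by move=> k u0; rewrite ler1n.
Qed.

(** Each utility is at most [c|G|]; the successor covers the factor 1 of agents without utility when
    [G] is empty. *)
Lemma nash_product_le Y : nash_product v Y <= ((c * #|G|).+1 ^ n)%:R.
Proof.
rewrite nash_productE -natr_prod ler_nat -[n in (_ ^ n)%N]card_ord -prod_nat_const.
rewrite big_mkcond; apply: leq_prod => k _; case: ifP => // _.
rewrite -[in leqRHS](prednK (ltnW c_ge2)) mulSn leqW // leq_add ?max_card //.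
by rewrite leq_mul2l (leq_trans (rank_card (rankP _) _)) ?max_card ?orbT.
Qed.

(** An additional agent with positive utility is worth a factor [M], which exceeds every Nash
    product, while all Nash products are at least 1. *)
Lemma welfare_max_nash X : ((c * #|G|).+1 ^ n)%:R < M ->
  (forall Y, welfare M (val_nat Y) <= welfare M (val_nat X)) -> max_nash_welfare v X.
Proof.
move=> Mbig opt; have M0 : 0 < M by have := M_gt2; lra.
have le_n (A : {set 'I_n}) : (#|A| <= n)%N by rewrite -[leqRHS]card_ord max_card.
split=> Y; last first.
  move=> e; have := opt Y; rewrite !welfare_nashE e ler_pM2l //.
  by rewrite exprn_gt0 // invr_gt0.
rewrite leqNgt; apply/negP => lt; have := opt Y; apply/negP; rewrite -ltNge.
rewrite !welfare_nashE.
have leY := le_n (positive_agents v Y).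
have -> : (n - #|positive_agents v X| = (n - #|positive_agents v Y|) +
   (#|positive_agents v Y| - #|positive_agents v X|))%N by lia.
rewrite exprD -mulrA ltr_pM2l ?exprn_gt0 ?invr_gt0 // exprVn mulrC.
rewrite ltr_pdivrMr ?exprn_gt0 //; apply: (le_lt_trans (nash_product_le X)).
apply: (lt_le_trans Mbig); apply: (@le_trans _ _ (M ^+ (#|positive_agents v Y| - #|positive_agents v X|))).
  by rewrite -{1}[M]expr1 ler_weXn2l ?subn_gt0 //; have := M_gt2; lra.
by rewrite ler_peMl ?nash_product_ge1 // exprn_ge0 // ltW.
Qed.

End Algorithm.

Theorem theorem6p1 (R : realType) (n : nat) (G : finType) (c : nat)
    (v : 'I_n -> {set G} -> R)
    (n_gt0 : (0 < n)%N) (c_ge2 : (2 <= c)%N)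
    (v_ge0 : forall (i : 'I_n) (S : {set G}), 0 <= v i S)
    (v_SUB : forall i : 'I_n, one_c_SUB c%:R (v i)) :
  exists M0 : R, forall M : R, 0 < M -> M0 <= M ->
    yankee_swap_computes c%:R v (nash_gain v M) (max_nash_welfare v).
Proof.
(* The threshold makes [M] exceed both the bound on Nash products and 2. *)
exists ((c * #|G|).+1 ^ n + 3)%:R => M _ leM.
have M_gt2 : 2 < M by apply: lt_le_trans leM; rewrite ltr_nat; lia.
apply: (all_runs_optimal n_gt0 c_ge2 v_SUB M_gt2) => X.
apply: welfare_max_nash => //; apply: lt_le_trans leM; rewrite ltr_nat; lia.
Qed.
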